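(* Let $g\in L^\infty(\mathbf{R}\times\mathbf{R})$ and let $u\in C(\mathbf{R}\times\mathbf{R};[0,1])$ be a continuous and isentropic solution of the Burgers equation with source $g$, that is, $\partial_t u+\partial_x(\tfrac12u^2)=g$ in the sense of distributions. Then (for every $t\in\mathbf{R}$) $u(t,\cdot)$ is $\tfrac12$-Hölder continuous on $\mathbf{R}$ with constant at most $100\cdot\big(20\,\|g\|_{L^\infty(\mathbf{R}\times\mathbf{R})}\big)^{1/2}$.
   Context: Here $(t,x)\in\mathbf{R}\times\mathbf{R}$ and the flux is $f(u)=\tfrac12u^2$. A continuous solution $u$ with values in $[0,1]$ is isentropic if for every entropy-entropy flux pair $(\eta,q)$ (that is, $\eta$ is convex and differentiable and $q'(v)=\eta'(v)f'(v)$ for every $v$) one has $\partial_t\eta(u)+\partial_x q(u)=\eta'(u)\,g$ in the sense of distributions. *)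

(* Defs.v *)
From HB Require Import structures.
From mathcomp Require Import all_boot all_order all_algebra.
From mathcomp Require Import all_classical all_reals all_analysis.

Set Implicit Arguments.
Unset Strict Implicit.
Unset Printing Implicit Defensive.

Import Order.TTheory GRing.Theory Num.Theory.
Import numFieldNormedType.Exports.

Local Open Scope classical_set_scope.
Local Open Scope ring_scope.

(* Points of the plane are p = (t, x): time first, space second. *)

Definition lebesgue2 (R : realType) :
    {measure set (measurableTypeR R * measurableTypeR R) -> \bar R} :=
  [the measure _ _ of (@lebesgue_measure R \x @lebesgue_measure R)%E].

Definition dt (R : realType) (phi : R * R -> R) : R * R -> R :=
  fun p => 'D_((1, 0) : R * R) phi p.

Definition dx (R : realType) (phi : R * R -> R) : R * R -> R :=
  fun p => 'D_((0, 1) : R * R) phi p.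

(* All partial derivatives of order at most k exist and are continuous. *)
Fixpoint Ck (R : realType) (k : nat) (phi : R * R -> R) : Prop :=
  continuous phi /\
  if k is k'.+1 then
    [/\ forall p, derivable phi p ((1, 0) : R * R),
        forall p, derivable phi p ((0, 1) : R * R),
        Ck k' (dt phi) & Ck k' (dx phi)]
  else True.

Definition test_function (R : realType) (phi : R * R -> R) : Prop :=
  (forall k, Ck k phi) /\ compact (closure [set p | phi p != 0]).

(* d_t a + d_x b = h in the sense of distributions. *)
Definition distr_balance (R : realType) (a b h : R * R -> R) : Prop :=
  forall phi : R * R -> R, test_function phi ->
    - (\int[lebesgue2 R]_p (a p * dt phi p + b p * dx phi p))
    = \int[lebesgue2 R]_p (h p * phi p).

Definition burgers_flux {R : realType} (v : R) : R := 2^-1 * v ^+ 2.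

Definition burgers_solution (R : realType) (g u : R * R -> R) : Prop :=
  distr_balance u (burgers_flux \o u) g.

Definition entropy_pair (R : realType) (eta q : R -> R) : Prop :=
  [/\ convex_function (setT : set R^o) eta,
      forall v : R, derivable eta v 1 &
      forall v : R, is_derive v 1 q (derive1 eta v * derive1 burgers_flux v)].

Definition isentropic (R : realType) (g u : R * R -> R) : Prop :=
  forall eta q : R -> R, entropy_pair eta q ->
    distr_balance (eta \o u) (q \o u) (fun p => derive1 eta (u p) * g p).

Definition Linfty (R : realType) (g : R * R -> R) : Prop :=
  g \in Lfun (lebesgue2 R) +oo%E.

Definition Linfty_norm (R : realType) (g : R * R -> R) : R :=
  fine 'N[lebesgue2 R]_+oo[EFin \o g]%E.

(* v is alpha-Hoelder continuous with constant at most C. *)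
Definition hoelder_le (R : realType) (alpha C : R) (v : R -> R) : Prop :=
  forall x y, `|v x - v y| <= C * `|x - y| `^ alpha.

(* Main.v *)
(* Dafermos' argument: let G be the L^oo norm of g, and integrate the balance
   law over a thin strip lying on one side of a curve xi. Through an edge moving
   with speed xi' the flux is u^2/2 - xi' u = (u - xi')^2/2 - xi'^2/2. The last
   term cancels between the two edges, and the square is nonnegative on the far
   edge and negligible on the near one when xi' is close to u(t, xi). Strips on
   the left and on the right of xi then show that u(s', xi s') - u(s, xi s) is
   bounded by G (s' - s) up to small errors.
   Let d = |u(t, x) - u(t, y)|. Smooth approximate characteristics from x and y,
   run forward or backward in time so that they approach each other, meet within
   time d / (8 G) if d^2 > 32 G |x - y|, although u differs by at least d/2
   between them during that time; hence d^2 <= 32 G |x - y|. *)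
Require Import Defs.
From HB Require Import structures.
From mathcomp Require Import all_boot all_order all_algebra.
From mathcomp Require Import all_classical all_reals all_analysis.
From mathcomp Require Import measurable_realfun ess_sup_inf ring lra.

Set Implicit Arguments.
Unset Strict Implicit.

Import Order.TTheory GRing.Theory Num.Theory.
Import numFieldNormedType.Exports.

Local Open Scope classical_set_scope.
Local Open Scope ring_scope.

(** Characteristics of a merely continuous u are in general only of class C^1 and not unique,
    whereas test functions must be smooth. The strips therefore follow smooth curves whose slope
    misses u by at most [delta]. Dividing the balance on a strip of width [eps] by the mass of its
    cross section leaves two errors: one of order [delta ^+ 2 / eps] from the near edge, and the
    oscillation of u across the strip. Hence the parameters are chosen in the order [eps], [delta],
    edge thickness [r]. The last one costs nothing, since an edge profile has mass 1 whatever its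
    thickness. The far edge offers no smallness, only a sign, so each side of the curve yields just
    one of the two inequalities. Values of u along a curve are always compared with the value at its
    starting point, so the curves from x and y may be any approximate characteristics, and the
    bounds persist even after they cross. *)

(** * Smooth functions of one variable *)

Fixpoint Ck1 (R : realType) (k : nat) (f : R -> R) : Prop :=
  if k is k'.+1 then
    exists2 df : R -> R, (forall x : R, is_derive x 1 f (df x)) & Ck1 k' df
  else continuous f.

Lemma is_derive_continuous (R : realType) (f df : R -> R) :
  (forall x : R, is_derive x 1 f (df x)) -> continuous f.
Proof. by move=> dfE x; apply/differentiable_continuous/derivable1_diffP. Qed.

Lemma is_derive_unique (R : realType) (f df dg : R -> R) :
  (forall x : R, is_derive x 1 f (df x)) -> (forall x : R, is_derive x 1 f (dg x)) ->
  df = dg.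
Proof.
move=> f1 f2; apply/funext => x.
by rewrite -(@derive_val _ _ _ _ _ _ _ (f1 x)) (@derive_val _ _ _ _ _ _ _ (f2 x)).
Qed.

Lemma Ck1W (R : realType) (k : nat) (f : R -> R) : Ck1 k.+1 f -> Ck1 k f.
Proof.
elim: k f => [|k IH] f; first by case=> df fE _; exact: is_derive_continuous fE.
by case=> df fE dfk; exists df => //; exact: IH.
Qed.

Lemma Ck1_cst (R : realType) (k : nat) (c : R) : Ck1 k (fun=> c).
Proof.
elim: k c => [|k IH] c; first exact: cst_continuous.
by exists (fun=> 0); [move=> x; exact: is_derive_cst|exact: IH].
Qed.

Lemma Ck1_id (R : realType) (k : nat) : Ck1 k (fun x : R => x).
Proof.
case: k => [|k] /=; first by move=> x; exact: cvg_id.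
by exists (fun=> 1); [move=> x; exact: is_derive_id|exact: Ck1_cst].
Qed.

Lemma Ck1D (R : realType) (k : nat) (f g : R -> R) :
  Ck1 k f -> Ck1 k g -> Ck1 k (fun x => f x + g x).
Proof.
elim: k f g => [|k IH] f g /=; first by move=> cf cg x; apply: cvgD; [exact: cf|exact: cg].
move=> [df fE dfk] [dg gE dgk]; exists (fun x => df x + dg x); last exact: IH.
by move=> x; exact: is_deriveD.
Qed.

Lemma Ck1M (R : realType) (k : nat) (f g : R -> R) :
  Ck1 k f -> Ck1 k g -> Ck1 k (fun x => f x * g x).
Proof.
elim: k f g => [|k IH] f g; first by move=> cf cg x; apply: cvgM; [exact: cf|exact: cg].
move=> fk gk; move: (fk) (gk) => [df fE dfk] [dg gE dgk].
exists (fun x => f x * dg x + g x * df x).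
  by move=> x; exact: is_deriveM.
by apply: Ck1D; apply: IH => //; exact: Ck1W.
Qed.

Lemma Ck1V (R : realType) (k : nat) (f : R -> R) :
  (forall x, f x != 0) -> Ck1 k f -> Ck1 k (fun x => (f x)^-1).
Proof.
move=> f0; elim: k f f0 => [|k IH] f f0; first by move=> cf x; apply: cvgV; [exact: f0|exact: cf].
move=> fk; move: (fk) => [df fE dfk].
exists (fun x => - (f x) ^- 2 * df x).
  by move=> x; exact: is_deriveV.
have Vk := IH _ f0 (Ck1W fk).
have -> : (fun x => - f x ^- 2 * df x) = (fun x => -1 * ((f x)^-1 * (f x)^-1 * df x)).
  by apply/funext => x; rewrite mulN1r mulNr expr2 invfM.
by apply: Ck1M; [exact: Ck1_cst|apply: Ck1M => //; exact: Ck1M].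
Qed.

Lemma Ck1_comp (R : realType) (k : nat) (f g : R -> R) :
  Ck1 k f -> Ck1 k g -> Ck1 k (fun x => f (g x)).
Proof.
elim: k f g => [|k IH] f g; first by move=> cf cg x; exact: (continuous_comp (cg x) (cf _)).
move=> fk gk; move: (fk) (gk) => [df fE dfk] [dg gE dgk].
exists (fun x => df (g x) * dg x).
  by move=> x; exact: is_derive1_comp.
by apply: Ck1M => //; apply: IH => //; exact: Ck1W.
Qed.

(** Each [Ck1 k f] brings its own witness for the derivative; as derivatives are unique, a single
    [df] serves all k. *)
Lemma smooth_derive (R : realType) (f : R -> R) : (forall k, Ck1 k f) ->
  exists2 df : R -> R, (forall x : R, is_derive x 1 f (df x)) & forall k, Ck1 k df.
Proof.
move=> fk; have [df fE _] := fk 1%N; exists df => // k.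
by have [dg gE gk] := fk k.+1; rewrite (is_derive_unique fE gE).
Qed.

Lemma smooth_derive_continuous (R : realType) (f df : R -> R) :
  (forall k, Ck1 k f) -> (forall x : R, is_derive x 1 f (df x)) -> continuous df.
Proof.
move=> fk fE; have [dg gE gk] := smooth_derive fk.
by rewrite (is_derive_unique fE gE); exact: (gk 0%N).
Qed.

Lemma is_derive_locally_cst (R : realType) (f : R -> R) (x d c : R) :
  (\forall y \near x, f y = c) -> is_derive x 1 f d -> d = 0.
Proof.
move=> fc fd; have h : is_derive x 1 f 0.
  apply: (@near_eq_is_derive R R R (fun=> c)).
    by near=> y; apply/esym; near: y.
by rewrite -(@derive_val _ _ _ _ _ _ _ fd) (@derive_val _ _ _ _ _ _ _ h).
Unshelve. all: by end_near. Qed.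

Lemma is_derive_affine (R : realType) (f : R -> R) (df : R -> R) (c r x : R) :
  (forall x : R, is_derive x 1 f (df x)) ->
  is_derive x 1 (fun y => f ((y - c) / r)) (df ((x - c) / r) / r).
Proof.
move=> fE.
have h : is_derive x 1 (fun y : R => (y - c) / r) r^-1.
  have h1 := is_deriveB (is_derive_id x 1) (is_derive_cst (c : R) x 1).
  apply: (is_derive_eq (is_deriveM h1 (is_derive_cst (r^-1 : R) x 1))).
  by rewrite /GRing.scale/= mulr0 add0r subr0 mulr1.
exact: (@is_derive1_comp _ f (fun y => (y - c) / r) x _ _ (fE _) h).
Qed.

(** * Bumps and a smooth step *)

(** Smoothness is left out on purpose: the edge profiles, being parts of a derivative, serve only as
    nonnegative weights under an integral. *)
Definition bump (R : realType) (a b : R) (f : R -> R) : Prop :=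
  [/\ continuous f, forall x, 0 <= f x & forall x, ~~ (a <= x <= b) -> f x = 0].

(* Up to linear combinations this family is closed under derivation, which makes
   each member smooth. *)
Definition flat (R : realType) (n : nat) (x : R) : R :=
  if 0 < x then x^-1 ^+ n * expR (- x^-1) else 0.

Lemma flat_ge0 (R : realType) (n : nat) (x : R) : 0 <= flat n x.
Proof.
rewrite /flat; case: ifPn => // x0.
by rewrite mulr_ge0 ?expR_ge0// exprn_ge0// invr_ge0 ltW.
Qed.

Lemma flat_gt0 (R : realType) (n : nat) (x : R) : 0 < x -> 0 < flat n x.
Proof. by move=> x0; rewrite /flat x0 mulr_gt0 ?expR_gt0// exprn_gt0// invr_gt0. Qed.

Lemma flat_le0 (R : realType) (n : nat) (x : R) : x <= 0 -> flat n x = 0.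
Proof. by rewrite /flat ltNge => ->. Qed.

(** With y = 1/x this is one term of the exponential series, y^(n+2) / (n+2)! <= exp y. The
    quadratic decay makes the difference quotient of [flat n] at the origin tend to 0. *)
Lemma flat_le (R : realType) (n : nat) (x : R) : 0 <= x ->
  flat n x <= (n.+2)`!%:R * x ^+ 2.
Proof.
rewrite le_eqVlt => /predU1P[<-|x0]; first by rewrite flat_le0// mulr_ge0// sqr_ge0.
have y0 : 0 < x^-1 by rewrite invr_gt0.
have xE : x = x^-1^-1 by rewrite invrK.
have := @expR_ge1Dxn R x^-1 n.+1 (ltW y0).
rewrite /flat x0 [X in _ * X ^+ 2]xE; move: (x^-1) y0 => y y0 yE.
have fact0 : 0 < (n.+2)`!%:R :> R by rewrite ltr0n fact_gt0.
have {}yE : y ^+ n.+2 / (n.+2)`!%:R <= expR y.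
  by apply: le_trans yE; rewrite lerDr.
rewrite expRN ler_pdivrMr ?expR_gt0// exprVn -mulrA.
rewrite -ler_pdivrMl// mulrC ler_pdivlMl ?exprn_gt0//.
by rewrite mulrA -exprD add2n.
Qed.

Lemma is_derive_flat (R : realType) (n : nat) (x : R) :
  is_derive x 1 (flat n) (flat n.+2 x - n%:R * flat n.+1 x).
Proof.
have [x0|x0|->] := ltgtP x 0.
- rewrite !flat_le0 ?ltW// mulr0 subr0.
  apply: (@near_eq_is_derive R R R (fun=> 0)).
  near=> y; rewrite flat_le0// ltW//; near: y; exact: lt_nbhsl.
- apply: (@near_eq_is_derive R R R (fun y : R => y^-1 ^+ n * expR (- y^-1))).
    near=> y; rewrite /flat; suff -> : 0 < y by [].
    by near: y; exact: lt_nbhsr.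
  have xn0 : x != 0 by rewrite gt_eqF.
  have dV : is_derive x 1 (fun y : R => y^-1) (- x ^- 2).
    have := @is_deriveV R id x 1 1 xn0 (is_derive_id _ _).
    by rewrite /GRing.scale/= mulr1.
  have dX : is_derive x 1 (fun y : R => y^-1 ^+ n) (n%:R * x^-1 ^+ n.-1 * (- x ^- 2)).
    have -> : (fun y : R => y^-1 ^+ n) = (fun y : R => y^-1) ^+ n.
      by apply/funext => y; rewrite fctE.
    by apply: (is_derive_eq (is_deriveX n dV)); rewrite /GRing.scale/= mulr_natl.
  have dN : is_derive x 1 (fun y : R => - y^-1) (x ^- 2).
    by apply: is_derive_eq; rewrite opprK.
  have dE : is_derive x 1 (fun y : R => expR (- y^-1)) (expR (- x^-1) * x ^- 2).
    exact: (@is_derive1_comp _ expR (fun y => - y^-1)).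
  apply: (is_derive_eq (is_deriveM dX dE)); rewrite /flat x0 /GRing.scale/=.
  case: n dX => [|n] dX; rewrite /= !exprS !expr0; field => //.
- rewrite !flat_le0// mulr0 subr0.
  have cvg0 : (fun h : R => h^-1 *: ((flat n \o shift 0) (h *: 1) - flat n 0))
      @ 0^' --> (0 : R).
    rewrite [X in X @ _ --> _](_ : _ = (fun h : R => h^-1 * flat n h)); last first.
      by apply/funext => h /=; rewrite addr0 (@flat_le0 _ n 0)// subr0 [_ *: 1]mulr1.
    apply: cvg_within_filter; apply/cvgr0Pnorm_le => e e0.
    near=> h.
    have [h0|h0] := leP h 0; first by rewrite flat_le0// mulr0 normr0 ltW.
    rewrite ger0_norm; last by rewrite mulr_ge0 ?flat_ge0// invr_ge0 ltW.
    apply: (@le_trans _ _ (h^-1 * ((n.+2)`!%:R * h ^+ 2))).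
      by rewrite ler_wpM2l ?invr_ge0 ?(ltW h0)// flat_le// ltW.
    have -> : h^-1 * (n.+2`!%:R * h ^+ 2) = n.+2`!%:R * h.
      by field; rewrite gt_eqF.
    rewrite mulrC -ler_pdivlMr ?ltr0n ?fact_gt0//.
    rewrite ltW//; near: h; apply: lt_nbhsl; rewrite divr_gt0// ltr0n fact_gt0.
  apply: DeriveDef; first by apply/cvg_ex; exists 0.
  exact: cvg_lim cvg0.
Unshelve. all: by end_near. Qed.

Lemma Ck1_flat (R : realType) (k n : nat) : Ck1 k (@flat R n).
Proof.
elim: k n => [|k IH] n.
  exact: is_derive_continuous (is_derive_flat n).
exists (fun x => flat n.+2 x - n%:R * flat n.+1 x); first exact: is_derive_flat.
have -> : (fun x : R => flat n.+2 x - n%:R * flat n.+1 x) =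
    (fun x => flat n.+2 x + - n%:R * flat n.+1 x).
  by apply/funext => x; rewrite mulNr.
by apply: Ck1D => //; apply: Ck1M => //; exact: Ck1_cst.
Qed.

Lemma smooth_step_exists (R : realType) : exists S s : R -> R,
  [/\ forall k, Ck1 k S, forall x : R, is_derive x 1 S (s x), bump 0 1 s,
      {homo S : x y / x <= y} &
      (forall x, x <= 0 -> S x = 0) /\ (forall x, 1 <= x -> S x = 1)].
Proof.
suff [S [s [SD SE s0 S0 S1]]] : exists S s : R -> R,
  [/\ forall k, Ck1 k S, forall x : R, is_derive x 1 S (s x),
      forall x, 0 <= s x, forall x, x <= 0 -> S x = 0 & forall x, 1 <= x -> S x = 1].
  exists S, s; split=> //; last first.
    move=> x y xy; apply: (@ger0_derive1_ndecr _ S x y) => //.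
    - by move=> z _; rewrite derive1E (@derive_val _ _ _ _ _ _ _ (SE z)).
    - by apply: continuous_subspaceT; exact: is_derive_continuous SE.
  split=> //; first exact: smooth_derive_continuous SE.
  move=> x; rewrite negb_and -!ltNge => /orP[x0|x1].
    apply: (@is_derive_locally_cst _ S x (s x) 0) => //.
    by near=> y; apply: S0; rewrite ltW//; near: y; exact: lt_nbhsl.
  apply: (@is_derive_locally_cst _ S x (s x) 1) => //.
  by near=> y; apply: S1; rewrite ltW//; near: y; exact: lt_nbhsr.
(* The step is f(x) / (f(x) + f(1 - x)) with f(x) = exp(-1/x) for x > 0 and 0 elsewhere. The
   denominator is positive because x and 1 - x are never both nonpositive. *)
pose f := @flat R 0; pose f' := @flat R 2.
have fE (x : R) : is_derive x 1 f (f' x).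
  by have := is_derive_flat 0 x; rewrite mul0r subr0.
have gE (x : R) : is_derive x 1 (fun y => f (1 - y)) (- f' (1 - x)).
  have h : is_derive x 1 (fun y : R => 1 - y) (-1).
    apply: (is_derive_eq (is_deriveB (is_derive_cst (1 : R) x 1) (is_derive_id x 1))).
    by rewrite sub0r.
  apply: (is_derive_eq (@is_derive1_comp _ f (fun y => 1 - y) x (f' (1 - x)) (-1) _ _)).
  by rewrite mulrN1.
pose D x := f x + f (1 - x).
have D0 x : 0 < D x.
  rewrite /D; have [x0|x0] := ltP 0 x.
    by rewrite ltr_wpDr ?flat_ge0 ?flat_gt0.
  by rewrite ltr_wpDl ?flat_ge0 ?flat_gt0//; lra.
have Dn0 x : D x != 0 by rewrite gt_eqF.
exists (fun x => f x * (D x)^-1).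
exists (fun x => (f' x * f (1 - x) + f x * f' (1 - x)) / D x ^+ 2).
split.
- move=> k; apply: Ck1M; first exact: Ck1_flat.
  apply: Ck1V => //; apply: Ck1D; first exact: Ck1_flat.
  apply: (@Ck1_comp _ _ f (fun x => 1 - x)); first exact: Ck1_flat.
  apply: Ck1D; first exact: Ck1_cst.
  have -> : (@GRing.opp R) = (fun x => -1 * x) by apply/funext => x; rewrite mulN1r.
  by apply: Ck1M; [exact: Ck1_cst|exact: Ck1_id].
- move=> x.
  have DE : is_derive x 1 D (f' x - f' (1 - x)) by exact: is_deriveD.
  have VE := is_deriveV (Dn0 x) DE.
  apply: (is_derive_eq (is_deriveM (fE x) VE)).
  by rewrite /GRing.scale/= /D; field; exact: Dn0.
- move=> x; rewrite divr_ge0 ?sqr_ge0// addr_ge0// mulr_ge0 ?flat_ge0//.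
- by move=> x x0; rewrite /f flat_le0// mul0r.
- move=> x x1; rewrite /D /f (@flat_le0 _ 0 (1 - x)); last lra.
  by rewrite addr0 divff// gt_eqF// flat_gt0//; lra.
Unshelve. all: by end_near. Qed.

(** * Strips along a curve as test functions *)

Lemma is_derive_dt (R : realType) (phi : R * R -> R) (p : R * R) (d : R) :
  is_derive p.1 1 (fun t => phi (t, p.2)) d ->
  is_derive p ((1, 0) : R * R) phi d.
Proof.
have E : (fun h : R => h^-1 *: ((phi \o shift p) (h *: ((1, 0) : R * R)) - phi p)) =
    (fun h => h^-1 *: (((fun t => phi (t, p.2)) \o shift p.1) (h *: (1 : R)) - phi (p.1, p.2))).
  apply/funext => h /=; case: p => t x /=; congr (_ *: (phi (_, _) - _)).
  by rewrite /= /GRing.scale/= mulr0 add0r.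
by case=> [d1 d2]; apply: DeriveDef; rewrite /derivable /derive E.
Qed.

Lemma is_derive_dx (R : realType) (phi : R * R -> R) (p : R * R) (d : R) :
  is_derive p.2 1 (fun x => phi (p.1, x)) d ->
  is_derive p ((0, 1) : R * R) phi d.
Proof.
have E : (fun h : R => h^-1 *: ((phi \o shift p) (h *: ((0, 1) : R * R)) - phi p)) =
    (fun h => h^-1 *: (((fun x => phi (p.1, x)) \o shift p.2) (h *: (1 : R)) - phi (p.1, p.2))).
  apply/funext => h /=; case: p => t x /=; congr (_ *: (phi (_, _) - _)).
  by rewrite /= /GRing.scale/= mulr0 add0r.
by case=> [d1 d2]; apply: DeriveDef; rewrite /derivable /derive E.
Qed.

Definition strip (R : realType) (xi alpha psi : R -> R) (p : R * R) : R :=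
  alpha p.1 * psi (p.2 - xi p.1).

Lemma strip_continuous (R : realType) (xi alpha psi : R -> R) :
  continuous xi -> continuous alpha -> continuous psi ->
  continuous (strip xi alpha psi).
Proof.
move=> cxi calpha cpsi p; apply: cvgM.
  by apply: (@continuous_comp _ _ _ fst alpha); [exact: cvg_fst|exact: calpha].
apply: (@continuous_comp _ _ _ (fun q => q.2 - xi q.1) psi); last exact: cpsi.
apply: cvgB; first exact: cvg_snd.
by apply: (@continuous_comp _ _ _ fst xi); [exact: cvg_fst|exact: cxi].
Qed.

Lemma is_derive_strip_t (R : realType) (xi alpha psi dxi dalpha dpsi : R -> R) (p : R * R) :
  (forall x : R, is_derive x 1 xi (dxi x)) ->
  (forall x : R, is_derive x 1 alpha (dalpha x)) ->
  (forall x : R, is_derive x 1 psi (dpsi x)) ->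
  is_derive p ((1, 0) : R * R) (strip xi alpha psi)
    (strip xi dalpha psi p - strip xi (fun t => alpha t * dxi t) dpsi p).
Proof.
move=> xiE alphaE psiE; apply: is_derive_dt; rewrite /strip /=.
have h : is_derive p.1 1 (fun t : R => p.2 - xi t) (- dxi p.1).
  apply: (is_derive_eq (is_deriveB (is_derive_cst (p.2 : R) p.1 1) (xiE p.1))).
  by rewrite sub0r.
have h2 := @is_derive1_comp _ psi (fun t => p.2 - xi t) p.1 _ _ (psiE _) h.
apply: (is_derive_eq (is_deriveM (alphaE p.1) h2)).
by rewrite /GRing.scale/=; ring.
Qed.

Lemma is_derive_strip_x (R : realType) (xi alpha psi dpsi : R -> R) (p : R * R) :
  (forall x : R, is_derive x 1 psi (dpsi x)) ->
  is_derive p ((0, 1) : R * R) (strip xi alpha psi) (strip xi alpha dpsi p).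
Proof.
move=> psiE; apply: is_derive_dx; rewrite /strip /=.
have h : is_derive p.2 1 (fun x : R => x - xi p.1) 1.
  apply: (is_derive_eq (is_deriveB (is_derive_id p.2 1) (is_derive_cst (xi p.1 : R) p.2 1))).
  by rewrite subr0.
have h2 := @is_derive1_comp _ psi (fun x => x - xi p.1) p.2 _ _ (psiE _) h.
apply: (is_derive_eq (is_deriveM (is_derive_cst (alpha p.1 : R) p.2 1) h2)).
by rewrite /GRing.scale/=; ring.
Qed.

Lemma CkB (R : realType) (k : nat) (f g : R * R -> R) :
  Ck k f -> Ck k g -> Ck k (fun p => f p - g p).
Proof.
elim: k f g => [|k IH] f g /=.
  by move=> [cf _] [cg _]; split=> // p; apply: cvgB; [exact: cf|exact: cg].
move=> [cf [ft fx fkt fkx]] [cg [gt gx gkt gkx]]; split.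
  by move=> p; apply: cvgB; [exact: cf|exact: cg].
split.
- by move=> p; apply: derivableB.
- by move=> p; apply: derivableB.
- have -> : dt (fun p => f p - g p) = (fun p => dt f p - dt g p).
    by apply/funext => p; exact: deriveB.
  exact: IH.
- have -> : dx (fun p => f p - g p) = (fun p => dx f p - dx g p).
    by apply/funext => p; exact: deriveB.
  exact: IH.
Qed.

(** The induction has to run over all [alpha] and [psi]: the time derivative of a strip is a
    difference of two strips along the same curve, with the new profiles alpha', psi and alpha xi',
    psi'. *)
Lemma Ck_strip (R : realType) (k : nat) (xi alpha psi : R -> R) :
  (forall j, Ck1 j xi) -> (forall j, Ck1 j alpha) -> (forall j, Ck1 j psi) ->
  Ck k (strip xi alpha psi).
Proof.
move=> sxi; have [dxi xiE sdxi] := smooth_derive sxi.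
elim: k alpha psi => [|k IH] alpha psi salpha spsi.
  by split=> //; apply: strip_continuous; [exact: (sxi 0%N)|exact: (salpha 0%N)|exact: (spsi 0%N)].
have [dalpha alphaE sdalpha] := smooth_derive salpha.
have [dpsi psiE sdpsi] := smooth_derive spsi.
split.
  by apply: strip_continuous; [exact: (sxi 0%N)|exact: (salpha 0%N)|exact: (spsi 0%N)].
split.
- by move=> p; have [] := is_derive_strip_t p xiE alphaE psiE.
- by move=> p; have [] := is_derive_strip_x xi alpha p psiE.
- have -> : dt (strip xi alpha psi) = (fun p => strip xi dalpha psi p -
      strip xi (fun t => alpha t * dxi t) dpsi p).
    by apply/funext => p; have [] := is_derive_strip_t p xiE alphaE psiE.
  apply: CkB; first exact: IH.
  by apply: IH => // j; apply: Ck1M.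
- have -> : dx (strip xi alpha psi) = strip xi alpha dpsi.
    by apply/funext => p; have [] := is_derive_strip_x xi alpha p psiE.
  exact: IH.
Qed.

Lemma strip_eq0 (R : realType) (xi alpha psi : R -> R) (a b c d : R) :
  (forall t, ~~ (a <= t <= b) -> alpha t = 0) ->
  (forall y, ~~ (c <= y <= d) -> psi y = 0) ->
  forall p, ~ (a <= p.1 <= b /\ c <= p.2 - xi p.1 <= d) -> strip xi alpha psi p = 0.
Proof.
move=> alpha0 psi0 p np; rewrite /strip.
have [ab|/negP ab] := boolP (a <= p.1 <= b); last by rewrite alpha0 ?mul0r//; apply/negP.
have [cd|/negP cd] := boolP (c <= p.2 - xi p.1 <= d); last by rewrite psi0 ?mulr0//; apply/negP.
by exfalso; exact: np.
Qed.

(** On [a, b] the curve attains its extreme values, so the curved strip fits into a rectangle. *)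
Lemma strip_support (R : realType) (xi alpha psi : R -> R) (a b c d : R) :
  continuous xi -> a <= b ->
  (forall t, ~~ (a <= t <= b) -> alpha t = 0) ->
  (forall y, ~~ (c <= y <= d) -> psi y = 0) ->
  exists m M, forall p, strip xi alpha psi p != 0 ->
    (`[a, b] `*` `[m, M]) p.
Proof.
move=> cxi ab alpha0 psi0.
have cxi' : {within `[a, b], continuous xi} by exact: continuous_subspaceT.
have [s _ sM] := EVT_max ab cxi'.
have [s' _ sm] := EVT_min ab cxi'.
exists (c + xi s'), (d + xi s) => p.
apply: contra_neqP => np; apply: strip_eq0 alpha0 psi0 _ _ => -[h1 h2]; apply: np.
have p1 : p.1 \in `[a, b] by rewrite in_itv.
have := sM _ p1; have := sm _ p1 => hm hM.
by split => /=; rewrite in_itv/= //; lra.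
Qed.

Lemma test_function_strip (R : realType) (xi alpha psi : R -> R) (a b c d : R) :
  (forall j, Ck1 j xi) -> (forall j, Ck1 j alpha) -> (forall j, Ck1 j psi) ->
  a <= b ->
  (forall t, ~~ (a <= t <= b) -> alpha t = 0) ->
  (forall y, ~~ (c <= y <= d) -> psi y = 0) ->
  test_function (strip xi alpha psi).
Proof.
move=> sxi salpha spsi ab alpha0 psi0; split; first by move=> k; exact: Ck_strip.
have [m [M supp]] := strip_support (sxi 0%N) ab alpha0 psi0.
have cK : compact ((`[a, b] `*` `[m, M]) : set (R * R)).
  by apply: compact_setX; exact: segment_compact.
apply: (subclosed_compact _ cK); first exact: closed_closure.
have clK : closed ((`[a, b] `*` `[m, M]) : set (R * R)).
  by apply: compact_closed => //; exact: norm_hausdorff.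
move: clK => /closure_id ->.
by apply: closure_subset => p /supp.
Qed.

(** * Measurability and integration of strips *)

Lemma bigcup_measurable_countType (d : measure_display) (T : measurableType d)
    (I : countType) (P : set I) (F : I -> set T) :
  (forall i, measurable (F i)) -> measurable (\bigcup_(i in P) F i).
Proof.
move=> mF.
pose E n : set T :=
  if unpickle n is Some i then (if `[< P i >] then F i else set0) else set0.
have -> : \bigcup_(i in P) F i = \bigcup_n E n.
  apply/seteqP; split => x [i].
    by move=> Pi Fx; exists (pickle i); rewrite // /E pickleK asboolT.
  move=> _; rewrite /E; case: unpickle => // j.
  by case: ifPn => // /asboolP Pj Fj; exists j.
apply: bigcupT_measurable => n; rewrite /E; case: unpickle => // j.
by case: ifPn.
Qed.

(** Measurability on the plane refers to the product sigma-algebra. An open set belongs to it as a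
    countable union of open squares with rational centre and half-side. *)
Lemma open_measurable2 (R : realType) (U : set (R * R)) :
  open U -> measurable (U : set (measurableTypeR R * measurableTypeR R)).
Proof.
move=> oU.
pose B (q : rat * rat * rat) : set (R * R) :=
  `](ratr q.1.1 - ratr q.2 : R), (ratr q.1.1 + ratr q.2)[%classic `*`
  `](ratr q.1.2 - ratr q.2 : R), (ratr q.1.2 + ratr q.2)[%classic.
have -> : U = \bigcup_(q in [set q | B q `<=` U]) B q.
  apply/seteqP; split; last by move=> p [q qU /qU].
  move=> p Up.
  have /nbhs_ballP [e /= e0 eU] : nbhs p U by exact: open_nbhs_nbhs.
  have [r] : exists q : rat, ratr q \in `](0 : R), (e / 2)[.
    by apply: rat_in_itvoo; rewrite divr_gt0.
  rewrite in_itv/= => /andP[r0 re].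
  have [a] : exists q : rat, ratr q \in `](p.1 - ratr r), (p.1 + ratr r)[.
    by apply: rat_in_itvoo; lra.
  have [b] : exists q : rat, ratr q \in `](p.2 - ratr r), (p.2 + ratr r)[.
    by apply: rat_in_itvoo; lra.
  rewrite !in_itv/= => /andP[b1 b2] /andP[a1 a2].
  exists (a, b, r).
    move=> q [/=]; rewrite !in_itv/= => /andP[q1 q2] /andP[q3 q4].
    by apply: eU; split; rewrite /ball/= ltr_distl; apply/andP; split; lra.
  by split; rewrite /= in_itv/=; apply/andP; split; lra.
apply: bigcup_measurable_countType => q; apply: measurableX; exact: measurable_itv.
Qed.

Lemma continuous_measurable2 (R : realType) (u : R * R -> R) :
  continuous u ->
  measurable_fun [set: measurableTypeR R * measurableTypeR R] u.
Proof.
move=> /continuousP cu.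
apply: (measurability _ (RGenOpens.measurableE R)).
move=> _ [_ [a [b ->] <-]]; rewrite setTI.
by apply: open_measurable2; apply: cu; exact: interval_open.
Qed.

Lemma bump_integrable (R : realType) (a b : R) (f : R -> R) :
  bump a b f -> (@lebesgue_measure R).-integrable setT (EFin \o f).
Proof.
move=> [cf f0 fout].
have -> : EFin \o f = (EFin \o f) \_ `[a, b].
  apply/funext => x; rewrite patchE; case: ifPn => //= /negP xab.
  by rewrite fout//; apply/negP => h; apply: xab; rewrite inE/= in_itv.
have mab : measurable (`[a, b]%classic : set (measurableTypeR R)) by exact: measurable_itv.
apply: (@integrable_mkcond _ _ R (@lebesgue_measure R) _ (EFin \o f) mab).1.
apply: continuous_compact_integrable; first exact: segment_compact.
exact: continuous_subspaceT.
Qed.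

Lemma integral_translate (R : realType) (f : R -> R) (c : R) :
  continuous f -> (forall x, 0 <= f x) ->
  (\int[@lebesgue_measure R]_x (f (x - c))%:E = \int[@lebesgue_measure R]_x (f x)%:E)%E.
Proof.
move=> cf f0.
have dE (x : R) : is_derive x 1 (fun y : R => y - c) 1.
  apply: (is_derive_eq (is_deriveB (is_derive_id x 1) (is_derive_cst (c : R) x 1))).
  by rewrite subr0.
have d1E : derive1 (fun y : R => y - c) = fun=> 1.
  by apply/funext => x; rewrite derive1E (@derive_val _ _ _ _ _ _ _ (dE x)).
rewrite (@increasing_ge0_integration_by_substitutionT R (fun y => y - c) f)//.
- by apply: eq_integral => x _; rewrite fctE d1E mulr1.
- by move=> x y; rewrite ltrD2r.
- by rewrite d1E; exact: cst_continuous.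
- by rewrite d1E; exact: is_cvg_cst.
- by rewrite d1E; exact: is_cvg_cst.
- exact: cvg_addrr_Ny.
- exact: cvg_addrr.
Qed.

Section strip_integral.
Variables (R : realType) (xi alpha psi : R -> R) (a b c d : R).
Hypotheses (cxi : continuous xi) (balpha : bump a b alpha) (bpsi : bump c d psi).

Lemma measurable_strip :
  measurable_fun [set: measurableTypeR R * measurableTypeR R] (strip xi alpha psi).
Proof.
apply: continuous_measurable2.
by case: balpha bpsi => ca _ _ [cp _ _]; exact: strip_continuous.
Qed.

Lemma strip_ge0 p : 0 <= strip xi alpha psi p.
Proof. by case: balpha bpsi => _ a0 _ [_ p0 _]; exact: mulr_ge0. Qed.

(** The shear (t, x) -> (t, x - xi t) preserves area: by Tonelli, each time slice is a translate of
    [psi], whose integral does not depend on t. *)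
Lemma integral_strip :
  (\int[lebesgue2 R]_p (strip xi alpha psi p)%:E =
  ((\int[@lebesgue_measure R]_t alpha t) * (\int[@lebesgue_measure R]_y psi y))%:E)%E.
Proof.
have [ca a0 _] := balpha; have [cp p0 _] := bpsi.
have ia := bump_integrable balpha; have ip := bump_integrable bpsi.
rewrite fubini_tonelli1; last 2 first.
- by apply/measurable_EFinP; exact: measurable_strip.
- by move=> p; rewrite lee_fin strip_ge0.
rewrite /fubini_F /strip /=.
transitivity (\int[@lebesgue_measure R]_t
   ((alpha t)%:E * \int[@lebesgue_measure R]_y (psi y)%:E))%E.
  apply: eq_integral => t _.
  under eq_integral do rewrite EFinM.
  rewrite ge0_integralZl//.
  - by congr (_ * _)%E; exact: integral_translate.
  - apply/measurable_EFinP; apply: continuous_measurable_fun => x.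
    apply: (@continuous_comp _ _ _ (fun y => y - xi t) psi); last exact: cp.
    by apply: cvgB; [exact: cvg_id|exact: cvg_cst].
  - by move=> x _; rewrite lee_fin.
  - by rewrite lee_fin.
rewrite ge0_integralZr//.
- by rewrite EFinM /Rintegral !fineK//; exact: integrable_fin_num.
- by apply/measurable_EFinP; exact: continuous_measurable_fun.
- by move=> x _; rewrite lee_fin.
- by apply: integral_ge0 => x _; rewrite lee_fin.
Qed.

Lemma Rintegral_strip :
  \int[lebesgue2 R]_p strip xi alpha psi p =
  (\int[@lebesgue_measure R]_t alpha t) * (\int[@lebesgue_measure R]_y psi y).
Proof. by rewrite /Rintegral integral_strip. Qed.

Lemma integrable_strip :
  (lebesgue2 R).-integrable setT (EFin \o strip xi alpha psi).
Proof.
apply/integrableP; split; first by apply/measurable_EFinP; exact: measurable_strip.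
have -> : (\int[lebesgue2 R]_p `|(EFin \o strip xi alpha psi) p| =
    \int[lebesgue2 R]_p (strip xi alpha psi p)%:E)%E.
  by apply: eq_integral => p _; rewrite /= ger0_norm ?strip_ge0.
by rewrite integral_strip ltry.
Qed.

Lemma integrableM_strip (h : R * R -> R) (M : R) :
  measurable_fun [set: measurableTypeR R * measurableTypeR R] h ->
  (forall p, strip xi alpha psi p != 0 -> `|h p| <= M) ->
  (lebesgue2 R).-integrable setT (EFin \o (fun p => h p * strip xi alpha psi p)).
Proof.
move=> mh hM.
have iM : (lebesgue2 R).-integrable setT (fun p => M%:E * (strip xi alpha psi p)%:E)%E.
  by apply: integrableZl => //; exact: integrable_strip.
apply: (le_integrable measurableT _ _ iM).
  by apply/measurable_EFinP; apply: measurable_funM => //; exact: measurable_strip.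
move=> p _ /=; rewrite lee_fin (normrM (h p)) (normrM M).
have [s0|s0] := eqVneq (strip xi alpha psi p) 0; first by rewrite s0 normr0 !mulr0.
by rewrite ler_wpM2r// (le_trans (hM _ s0))// ler_norm.
Qed.

Lemma Rintegral_strip_le (h : R * R -> R) (m M : R) :
  measurable_fun [set: measurableTypeR R * measurableTypeR R] h ->
  (forall p, strip xi alpha psi p != 0 -> m <= h p <= M) ->
  m * ((\int[@lebesgue_measure R]_t alpha t) * (\int[@lebesgue_measure R]_y psi y))
  <= \int[lebesgue2 R]_p (h p * strip xi alpha psi p) <=
  M * ((\int[@lebesgue_measure R]_t alpha t) * (\int[@lebesgue_measure R]_y psi y)).
Proof.
move=> mh hmM.
have ih : (lebesgue2 R).-integrable setT (EFin \o (fun p => h p * strip xi alpha psi p)).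
  apply: (@integrableM_strip h (`|m| + `|M|)) => // p /hmM /andP[h1 h2].
  rewrite ler_norml; have := ler_norm M; have := ler_norm (- m); rewrite normrN.
  by have := normr_ge0 m; have := normr_ge0 M; move=> *; apply/andP; split; lra.
have iC (C : R) : (lebesgue2 R).-integrable setT (EFin \o (fun p => C * strip xi alpha psi p)).
  by apply: (@integrableM_strip (fun=> C) `|C|).
rewrite -Rintegral_strip -!RintegralZl//; [|exact: integrable_strip|exact: integrable_strip].
have key p : m * strip xi alpha psi p <= h p * strip xi alpha psi p <= M * strip xi alpha psi p.
  have [s0|s0] := eqVneq (strip xi alpha psi p) 0; first by rewrite s0 !mulr0 lexx.
  by have /andP[h1 h2] := hmM _ s0; rewrite !ler_wpM2r ?strip_ge0.
by apply/andP; split; apply: le_Rintegral => // p _; have /andP[] := key p.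
Qed.

End strip_integral.

(** * Masses of bumps, and plateaus with edges of unit mass *)

Lemma bump_Rintegral (R : realType) (a b : R) (f : R -> R) : bump a b f ->
  \int[@lebesgue_measure R]_x f x = \int[@lebesgue_measure R]_(x in `[a, b]) f x.
Proof.
move=> [_ _ fout]; rewrite [RHS]Rintegral_mkcond; apply: eq_Rintegral => x _.
rewrite patchE; case: ifPn => // /negP xab; rewrite fout//; apply/negP => h.
by apply: xab; rewrite inE/= in_itv.
Qed.

Lemma Rintegral_itv_cst1 (R : realType) (a b : R) : a <= b ->
  \int[@lebesgue_measure R]_(x in `[a, b]) 1 = b - a.
Proof.
move=> ab.
have mab : measurable (`[a, b]%classic : set (measurableTypeR R)) by exact: measurable_itv.
have mE : (@lebesgue_measure R `[a, b] = (b - a)%:E)%E.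
  by rewrite lebesgue_measure_itv/= lte_fin; case: ltP => //= ba; congr EFin; lra.
transitivity (1 * fine (@lebesgue_measure R `[a, b])); last by rewrite mE mul1r.
exact: Rintegral_cst.
Qed.

Lemma bump_Rintegral_le (R : realType) (a b : R) (f : R -> R) : a <= b ->
  bump a b f -> (forall x, f x <= 1) -> \int[@lebesgue_measure R]_x f x <= b - a.
Proof.
move=> ab bf f1; rewrite (bump_Rintegral bf).
have mab : measurable (`[a, b]%classic : set (measurableTypeR R)) by exact: measurable_itv.
rewrite -(Rintegral_itv_cst1 ab).
apply: le_Rintegral => //.
- exact: integrableS (bump_integrable bf).
- apply: continuous_compact_integrable; first exact: segment_compact.
  by apply: continuous_subspaceT => x; exact: cvg_cst.
Qed.

Lemma Rintegral_ge_bump (R : realType) (a b c d : R) (f : R -> R) : a <= b ->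
  bump c d f -> (forall x, a <= x <= b -> 1 <= f x) ->
  b - a <= \int[@lebesgue_measure R]_x f x.
Proof.
move=> ab bf f1.
have mab : measurable (`[a, b]%classic : set (measurableTypeR R)) by exact: measurable_itv.
have -> : b - a = \int[@lebesgue_measure R]_x ((fun=> 1 : R) \_ `[a, b]) x.
  by rewrite -(Rintegral_itv_cst1 ab) Rintegral_mkcond.
have i1 : (@lebesgue_measure R).-integrable (`[a, b]%classic : set (measurableTypeR R))
    (EFin \o (fun=> 1 : R)).
  apply: continuous_compact_integrable; first exact: segment_compact.
  by apply: continuous_subspaceT => x; exact: cvg_cst.
apply: le_Rintegral => //.
- have := (@integrable_mkcond _ _ R (@lebesgue_measure R) _ (EFin \o (fun=> 1 : R)) mab).1 i1.
  by rewrite restrict_EFin.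
- exact: bump_integrable bf.
- move=> x _; rewrite patchE; case: ifPn => [|_]; last by case: bf.
  by rewrite inE/= in_itv/=; exact: f1.
Qed.

(** A rising step at a minus a rising step at b - r, both rescaled to length r. Each edge has mass
    S(1) - S(0) = 1 independently of r. Such plateaus serve both as time cutoffs and as cross
    sections of strips. *)
Lemma plateau_exists (R : realType) (a b r : R) : 0 < r -> a + r <= b - r ->
  exists psi sl sr : R -> R,
  [/\ (forall k, Ck1 k psi) /\ (forall x : R, is_derive x 1 psi (sl x - sr x)),
      bump a b psi /\ (forall x, psi x <= 1),
      forall x, a + r <= x <= b - r -> psi x = 1,
      bump a (a + r) sl /\ bump (b - r) b sr &
      \int[@lebesgue_measure R]_x sl x = 1 /\ \int[@lebesgue_measure R]_x sr x = 1].
Proof.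
move=> r0 arb.
have [S [s [SD SE [cs s0 sout] Smono [S0 S1]]]] := smooth_step_exists R.
have SDc c k : Ck1 k (fun y => S ((y - c) / r)).
  apply: (@Ck1_comp _ _ S (fun y => (y - c) / r)) => //.
  by apply: Ck1M; [apply: Ck1D; [exact: Ck1_id|exact: Ck1_cst]|exact: Ck1_cst].
have SEc c (x : R) : is_derive x 1 (fun y => S ((y - c) / r)) (s ((x - c) / r) / r).
  exact: is_derive_affine.
have bs c : bump c (c + r) (fun y => s ((y - c) / r) / r).
  split.
  - move=> x; apply: cvgM; last exact: cvg_cst.
    apply: (@continuous_comp _ _ _ (fun y => (y - c) / r) s); last exact: cs.
    by apply: cvgM; [apply: cvgB; [exact: cvg_id|exact: cvg_cst]|exact: cvg_cst].
  - by move=> x; rewrite divr_ge0// ltW.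
  - move=> x xout; rewrite sout ?mul0r//; apply: contra xout.
    rewrite ler_pdivlMr// ler_pdivrMr// mul0r mul1r => /andP[? ?].
    by apply/andP; split; lra.
have int1 c : \int[@lebesgue_measure R]_x (s ((x - c) / r) / r) = 1.
  rewrite (bump_Rintegral (bs c)) /Rintegral.
  rewrite (@continuous_FTC2 _ _ (fun y => S ((y - c) / r)))/=.
  - rewrite S1; last by rewrite addrC addKr divff// gt_eqF.
    by rewrite S0 ?subr0// subrr mul0r.
  - by lra.
  - by apply: continuous_subspaceT; case: (bs c).
  - split.
    + by move=> x _; have [] := SEc c x.
    + by apply: cvg_at_right_filter; exact: (SDc c 0%N).
    + by apply: cvg_at_left_filter; exact: (SDc c 0%N).
  - by move=> x _; rewrite derive1E (@derive_val _ _ _ _ _ _ _ (SEc c x)).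
have S01 x : 0 <= S x <= 1.
  apply/andP; split.
    have [x0|x0] := leP x 0; first by rewrite S0.
    by rewrite -(S0 0)// Smono// ltW.
  have [x0|x0] := leP 1 x; first by rewrite S1.
  by rewrite -(S1 1)// Smono// ltW.
exists (fun y => S ((y - a) / r) - S ((y - (b - r)) / r)).
exists (fun y => s ((y - a) / r) / r), (fun y => s ((y - (b - r)) / r) / r).
split; last by [].
- split; last by move=> x; exact: is_deriveB.
  move=> k; have -> : (fun y => S ((y - a) / r) - S ((y - (b - r)) / r)) =
      (fun y => S ((y - a) / r) + -1 * S ((y - (b - r)) / r)).
    by apply/funext => y; rewrite mulN1r.
  by apply: Ck1D => //; apply: Ck1M => //; exact: Ck1_cst.
- split; last first.
    by move=> x; have /andP[h1 h2] := S01 ((x - a) / r);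
      have /andP[h3 h4] := S01 ((x - (b - r)) / r); lra.
  split.
  + by move=> x; apply: cvgB; [exact: (SDc _ 0%N)|exact: (SDc _ 0%N)].
  + move=> x; rewrite subr_ge0 Smono// ler_pM2r ?invr_gt0//; lra.
  + move=> x; rewrite negb_and -!ltNge => /orP[h|h].
      by rewrite !S0 ?subrr// ler_pdivrMr// mul0r; lra.
    by rewrite !S1 ?subrr// ler_pdivlMr// mul1r; lra.
- move=> x /andP[h1 h2]; rewrite S1; last by rewrite ler_pdivlMr// mul1r; lra.
  by rewrite S0 ?subr0// ler_pdivrMr// mul0r; lra.
- by split => //; have := bs (b - r); rewrite subrK.
Qed.

(** * The balance law on a strip and the bound along a curve *)

(* The Galilean-corrected flux: burgers_flux u - xi' u + xi'^2 / 2. *)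
Definition speed_defect (R : realType) (u : R * R -> R) (dxi : R -> R)
    (p : R * R) : R := 2^-1 * (u p - dxi p.1) ^+ 2.

Lemma measurable_speed_defect (R : realType) (u : R * R -> R) (dxi : R -> R) :
  continuous u -> continuous dxi ->
  measurable_fun [set: measurableTypeR R * measurableTypeR R] (speed_defect u dxi).
Proof.
move=> cu cdxi; apply: continuous_measurable2 => p.
apply: cvgM; first exact: cvg_cst.
apply: (@continuous_comp _ _ _ (fun p => u p - dxi p.1) (fun x => x ^+ 2));
  last exact: exprn_continuous.
apply: cvgB; first exact: cu.
by apply: (@continuous_comp _ _ _ fst dxi); [exact: cvg_fst|exact: cdxi].
Qed.

(* The terms in xi'^2 / 2 drop out because both edges of Psi have the same mass. *)
Lemma strip_balance (R : realType) (g u : R * R -> R) (xi dxi : R -> R)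
    (X b1 b2 Psi c1 c2 : R -> R) (s s' t1 t2 c d e1 e2 : R) :
  continuous u -> (forall p, 0 <= u p <= 1) -> burgers_solution g u ->
  (forall k, Ck1 k xi) -> (forall x : R, is_derive x 1 xi (dxi x)) ->
  s <= s' ->
  (forall k, Ck1 k X) -> (forall k, Ck1 k Psi) ->
  (forall x : R, is_derive x 1 X (b1 x - b2 x)) ->
  (forall x : R, is_derive x 1 Psi (c1 x - c2 x)) ->
  bump s s' X -> bump c d Psi -> bump s t1 b1 -> bump t2 s' b2 ->
  bump c e1 c1 -> bump e2 d c2 ->
  \int[@lebesgue_measure R]_x c1 x = \int[@lebesgue_measure R]_x c2 x ->
  \int[lebesgue2 R]_p (u p * strip xi b2 Psi p) -
  \int[lebesgue2 R]_p (u p * strip xi b1 Psi p) =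
  \int[lebesgue2 R]_p (speed_defect u dxi p * strip xi X c1 p) -
  \int[lebesgue2 R]_p (speed_defect u dxi p * strip xi X c2 p) +
  \int[lebesgue2 R]_p (g p * strip xi X Psi p).
Proof.
move=> u_cont u_range u_sol xi_smooth xiE ss' sX sPsi XE PsiE bX bPsi bb1 bb2 bc1 bc2 intc.
have cxi : continuous xi by exact: (xi_smooth 0%N).
have cdxi : continuous dxi by exact: smooth_derive_continuous xiE.
have mu2 := continuous_measurable2 u_cont.
have mdefect := measurable_speed_defect u_cont cdxi.
have tphi : test_function (strip xi X Psi).
  by apply: (@test_function_strip _ xi X Psi s s' c d) => //; [case: bX|case: bPsi].
have bal := u_sol _ tphi.
(* The slope of [xi] is bounded only locally; X confines time to [s, s'], where M bounds it, and
   this makes the terms with [speed_defect] integrable. *)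
have cn : continuous (fun t => `|dxi t|).
  by move=> x; apply: cvg_norm; exact: cdxi.
have [t _ tmax] := EVT_max ss' (continuous_subspaceT cn).
pose M := `|dxi t|.
have M0 : 0 <= M by exact: normr_ge0.
have dxiM (ps : R -> R) p : strip xi X ps p != 0 -> `|dxi p.1| <= M.
  move=> h; apply: tmax; rewrite in_itv/=.
  by apply: contra_neqT h => h; rewrite /strip; case: bX => _ _ ->; rewrite ?mul0r.
have iu (a psi : R -> R) a1 a2 p1 p2 : bump a1 a2 a -> bump p1 p2 psi ->
    (lebesgue2 R).-integrable setT (EFin \o (fun p => u p * strip xi a psi p)).
  move=> ba bpsi; apply: (integrableM_strip cxi ba bpsi (M := 1)) => // p _.
  by have /andP[u0 u1] := u_range p; rewrite ger0_norm.
have idef (psi : R -> R) p1 p2 : bump p1 p2 psi ->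
    (lebesgue2 R).-integrable setT (EFin \o (fun p => speed_defect u dxi p * strip xi X psi p)).
  move=> bpsi; apply: (integrableM_strip cxi bX bpsi (M := 2^-1 * (1 + M) ^+ 2)) => // p h.
  rewrite ger0_norm /speed_defect; last by rewrite mulr_ge0// sqr_ge0.
  rewrite ler_pM2l// -[leLHS]real_normK ?num_real// ler_sqr ?nnegrE ?addr_ge0//.
  rewrite (le_trans (ler_normB _ _))// lerD//; last exact: dxiM h.
  by have /andP[u0 u1] := u_range p; rewrite ger0_norm.
(* Absorbed into the time profile, xi'^2 / 2 leaves terms that are plain strips. Their integrals
   factor, so the equal masses of [c1] and [c2] cancel them. *)
have bQ : bump s s' (fun t => 2^-1 * dxi t ^+ 2 * X t).
  have [cX X0 Xout] := bX; split.
  - move=> x; apply: cvgM; last exact: cX.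
    apply: cvgM; first exact: cvg_cst.
    by apply: (@continuous_comp _ _ _ dxi (fun x => x ^+ 2)); [exact: cdxi|exact: exprn_continuous].
  - by move=> x; rewrite mulr_ge0// mulr_ge0// sqr_ge0.
  - by move=> x /Xout ->; rewrite mulr0.
have pw : forall p, u p * dt (strip xi X Psi) p + (burgers_flux \o u) p * dx (strip xi X Psi) p =
   ((u p * strip xi b1 Psi p - u p * strip xi b2 Psi p) +
   (speed_defect u dxi p * strip xi X c1 p - speed_defect u dxi p * strip xi X c2 p)) -
   (strip xi (fun t => 2^-1 * dxi t ^+ 2 * X t) c1 p -
    strip xi (fun t => 2^-1 * dxi t ^+ 2 * X t) c2 p).
  move=> p; have [_ ht] := is_derive_strip_t p xiE XE PsiE.
  have [_ hx] := is_derive_strip_x xi X p PsiE.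
  rewrite /dt /dx ht hx /speed_defect /strip /burgers_flux /=; by field.
have i1 := iu _ _ _ _ _ _ bb1 bPsi.
have i2 := iu _ _ _ _ _ _ bb2 bPsi.
have i3 := idef _ _ _ bc1.
have i4 := idef _ _ _ bc2.
have i5 := integrable_strip cxi bQ bc1.
have i6 := integrable_strip cxi bQ bc2.
have iB (f1 f2 : R * R -> R) : (lebesgue2 R).-integrable setT (EFin \o f1) ->
    (lebesgue2 R).-integrable setT (EFin \o f2) ->
    (lebesgue2 R).-integrable setT (EFin \o (fun p => f1 p - f2 p)).
  by move=> h1 h2; exact: (integrableB measurableT h1 h2).
have iD (f1 f2 : R * R -> R) : (lebesgue2 R).-integrable setT (EFin \o f1) ->
    (lebesgue2 R).-integrable setT (EFin \o f2) ->
    (lebesgue2 R).-integrable setT (EFin \o (fun p => f1 p + f2 p)).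
  by move=> h1 h2; exact: (integrableD measurableT h1 h2).
have balE : \int[lebesgue2 R]_p (u p * dt (strip xi X Psi) p +
    (burgers_flux \o u) p * dx (strip xi X Psi) p) =
   (\int[lebesgue2 R]_p (u p * strip xi b1 Psi p) -
    \int[lebesgue2 R]_p (u p * strip xi b2 Psi p)) +
   (\int[lebesgue2 R]_p (speed_defect u dxi p * strip xi X c1 p) -
    \int[lebesgue2 R]_p (speed_defect u dxi p * strip xi X c2 p)).
  transitivity (\int[lebesgue2 R]_p
    (((u p * strip xi b1 Psi p - u p * strip xi b2 Psi p) +
      (speed_defect u dxi p * strip xi X c1 p - speed_defect u dxi p * strip xi X c2 p)) -
     (strip xi (fun t => 2^-1 * dxi t ^+ 2 * X t) c1 p -
      strip xi (fun t => 2^-1 * dxi t ^+ 2 * X t) c2 p))).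
    by apply: eq_Rintegral => p _; exact: pw.
  have i12 := iB _ _ i1 i2; have i34 := iB _ _ i3 i4.
  rewrite (RintegralB measurableT (iD _ _ i12 i34) (iB _ _ i5 i6)).
  rewrite (RintegralD measurableT i12 i34) (RintegralB measurableT i1 i2).
  rewrite (RintegralB measurableT i3 i4) (RintegralB measurableT i5 i6).
  by rewrite (Rintegral_strip cxi bQ bc1) (Rintegral_strip cxi bQ bc2) intc subrr subr0.
have {bal} : - (\int[lebesgue2 R]_p (u p * dt (strip xi X Psi) p +
    (burgers_flux \o u) p * dx (strip xi X Psi) p)) =
   \int[lebesgue2 R]_p (g p * strip xi X Psi p) by exact: bal.
by rewrite balE => <-; ring.
Qed.

Lemma strip_neq0 (R : realType) (xi alpha psi : R -> R) (a b c d : R) (p : R * R) :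
  bump a b alpha -> bump c d psi -> strip xi alpha psi p != 0 ->
  a <= p.1 <= b /\ c <= p.2 - xi p.1 <= d.
Proof.
move=> [_ _ a0] [_ _ p0] h; apply/not_notP => np; move/eqP: h; apply.
exact: strip_eq0 a0 p0 _ np.
Qed.

(** Here [eps] is the width of the strip, [r] the thickness of its edges and [eta] the oscillation
    of u across it. Each end value is replaced by an average of u that is off by at most 2 [eta]:
    one [eta] for moving in time along the curve, one for moving across the strip. The two ends
    together give 4 [eta]. *)
Lemma char_bound (R : realType) (g u : R * R -> R) (G : R) (xi dxi : R -> R)
    (s s' delta eps eta r : R) :
  measurable_fun [set: measurableTypeR R * measurableTypeR R] g ->
  (forall p, `|g p| <= G) -> continuous u -> (forall p, 0 <= u p <= 1) ->
  burgers_solution g u ->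
  (forall k, Ck1 k xi) -> (forall x : R, is_derive x 1 xi (dxi x)) ->
  s < s' -> 0 < r -> 4 * r <= eps -> 0 < eta ->
  (forall t, s <= t <= s' -> `|u (t, xi t) - dxi t| <= delta) ->
  (forall t x, s <= t <= s' -> `|x - xi t| <= r ->
    `|u (t, x) - u (t, xi t)| <= delta) ->
  (forall t x, s <= t <= s' -> `|x - xi t| <= eps ->
    `|u (t, x) - u (t, xi t)| <= eta) ->
  `|u (s', xi s') - u (s, xi s)| <=
    G * (s' - s) + 4 * eta + 4 * delta ^+ 2 * (s' - s) / eps.
Proof.
move=> mg g_le u_cont u_range u_sol xi_smooth xiE ss' r0 re eta0 h1 h2 h3.
have cxi : continuous xi by exact: (xi_smooth 0%N).
have cdxi : continuous dxi by exact: smooth_derive_continuous xiE.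
have G0 : 0 <= G by rewrite (le_trans _ (g_le (0, 0))).
have delta0 : 0 <= delta by rewrite (le_trans _ (h1 s _))// lexx ltW.
have mu := continuous_measurable2 u_cont.
pose v t := u (t, xi t).
have cv : continuous v.
  move=> t; apply: (@continuous_comp _ _ _ (fun t => (t, xi t)) u); last exact: u_cont.
  exact: (@cvg_pair _ _ _ (nbhs t) (nbhs t) (nbhs (xi t)) _ _ _ id xi (@cvg_id _ (nbhs t)) (cxi t)).
have nearv t : exists2 k, 0 < k & forall y, `|y - t| < k -> `|v y - v t| <= eta.
  have /cvgrPdist_le /(_ eta eta0) /nbhs_ballP [k /= k0 kP] := cv t.
  exists k => // y yt; rewrite distrC; apply: kP.
  by rewrite /ball/= distrC.
have [k1 k10 v1] := nearv s; have [k2 k20 v2] := nearv s'.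
(* With these halves the two time edges do not overlap, and on each of them v stays within [eta] of
   its value at the corresponding end. *)
pose kk := Num.min ((s' - s) / 2) (Num.min (k1 / 2) (k2 / 2)).
have kk0 : 0 < kk by rewrite !lt_min !divr_gt0// subr_gt0.
have [kks [kkk1 kkk2]] : kk <= (s' - s) / 2 /\ kk <= k1 / 2 /\ kk <= k2 / 2.
  by rewrite /kk !ge_min !lexx !orbT.
have [|X [b1 [b2 [[sX XE] [bX X1] _ [bb1 bb2] [ib1 ib2]]]]] :=
  @plateau_exists R s s' kk kk0; first by clear - kks; lra.
pose IX := \int[@lebesgue_measure R]_t X t.
have IX0 : 0 <= IX by apply: Rintegral_ge0 => x _; case: bX.
have IXle : IX <= s' - s by apply: (bump_Rintegral_le (ltW ss') bX).
have mdefect := measurable_speed_defect u_cont cdxi.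
have defect0 p : 0 <= speed_defect u dxi p by rewrite mulr_ge0// sqr_ge0.
(* c = 0 is a strip on the right of xi and d = 0 a strip on its left: only the
   edge touching xi has a defect bounded by delta. *)
have side c d : d - c = eps -> - eps <= c -> d <= eps -> exists K D1 D2 : R,
   [/\ eps / 2 <= K, `|(v s' - v s) * K - (D1 - D2)| <= G * (s' - s) * K + 4 * eta * K,
     0 <= D1 /\ 0 <= D2,
     c = 0 -> D1 <= 2 * delta ^+ 2 * (s' - s) &
     d = 0 -> D2 <= 2 * delta ^+ 2 * (s' - s)].
  move=> cd ce de.
  have [|Psi [c1 [c2 [[sPsi PsiE] [bPsi Psi1] Psiin [bc1 bc2] [ic1 ic2]]]]] :=
    @plateau_exists R c d r r0; first by clear - cd re r0; lra.
  have := strip_balance u_cont u_range u_sol xi_smooth xiE (ltW ss') sX sPsi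
    XE PsiE bX bPsi bb1 bb2 bc1 bc2 (etrans ic1 (esym ic2)).
  set A2 := \int[_]_p _; set A1 := \int[_]_p _; set D1 := \int[_]_p _.
  set D2 := \int[_]_p _; set J := \int[_]_p _ => bal.
  pose K := \int[@lebesgue_measure R]_y Psi y.
  (* As 4 r <= eps, the flat part of [Psi] has length eps - 2 r >= eps / 2. *)
  have Kge : eps / 2 <= K.
    apply: (@le_trans _ _ ((d - r) - (c + r))); first by clear - cd re; lra.
    apply: (Rintegral_ge_bump _ bPsi); first by clear - cd re r0; lra.
    by move=> x /Psiin ->.
  have uclose (t0 a1 a2 : R) (b : R -> R) : bump a1 a2 b -> s <= a1 -> a2 <= s' ->
      (forall t, a1 <= t <= a2 -> `|v t - v t0| <= eta) ->
      forall p, strip xi b Psi p != 0 -> v t0 - 2 * eta <= u p <= v t0 + 2 * eta.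
    move=> bb sa as' vt p /(strip_neq0 bb bPsi)[hp1 hp2].
    have st : s <= p.1 <= s'.
      by case/andP: hp1 => s1 s2; rewrite (le_trans sa s1) (le_trans s2 as').
    have := vt _ hp1; have := h3 p.1 p.2 st.
    rewrite -surjective_pairing -/(v p.1) !ler_norml => /(_ _)/andP[].
      by clear - hp2 ce de; case/andP: hp2 => *; apply/andP; split; lra.
    by clear; move=> q1 q2 /andP[q3 q4]; apply/andP; split; lra.
  have A1P : (v s - 2 * eta) * K <= A1 <= (v s + 2 * eta) * K.
    have := Rintegral_strip_le cxi bb1 bPsi mu (uclose s _ _ _ bb1 _ _ _).
    rewrite ib1 mul1r; apply; [by []|by clear - ss' kks; lra|].
    by move=> t /andP[t1 t2]; apply: v1; rewrite ltr_norml;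
      clear - t1 t2 kkk1 k10 kk0; apply/andP; split; lra.
  have A2P : (v s' - 2 * eta) * K <= A2 <= (v s' + 2 * eta) * K.
    have := Rintegral_strip_le cxi bb2 bPsi mu (uclose s' _ _ _ bb2 _ _ _).
    rewrite ib2 mul1r; apply; [by clear - ss' kks; lra|by []|].
    by move=> t /andP[t1 t2]; apply: v2; rewrite ltr_norml;
      clear - t1 t2 kkk2 k20 kk0; apply/andP; split; lra.
  have JP : - G * (IX * K) <= J <= G * (IX * K).
    apply: (Rintegral_strip_le cxi bX bPsi mg) => p _.
    by rewrite -ler_norml.
  have D0 a1 a2 ps : bump a1 a2 ps ->
      0 <= \int[lebesgue2 R]_p (speed_defect u dxi p * strip xi X ps p).
    by move=> bps; apply: Rintegral_ge0 => p _; rewrite mulr_ge0 ?(strip_ge0 xi bX bps).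
  (* On the near edge |u - xi'| <= 2 delta: one delta for the distance to the curve, at most r, and
     one for the slope error. Half its square is 2 delta^2, while the weight has mass at most s' -
     s. *)
  have Dle a1 a2 ps : bump a1 a2 ps -> - r <= a1 -> a2 <= r ->
     \int[@lebesgue_measure R]_y ps y = 1 ->
     \int[lebesgue2 R]_p (speed_defect u dxi p * strip xi X ps p) <= 2 * delta ^+ 2 * (s' - s).
    move=> bps ra1 ra2 ips.
    have /andP[_] : 0 * (IX * \int[@lebesgue_measure R]_y ps y) <=
      \int[lebesgue2 R]_p (speed_defect u dxi p * strip xi X ps p) <=
      2 * delta ^+ 2 * (IX * \int[@lebesgue_measure R]_y ps y).
      apply: (Rintegral_strip_le cxi bX bps mdefect) => p /(strip_neq0 bX bps)[hp1 hp2].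
      rewrite defect0 /speed_defect -[_ ^+ 2]real_normK ?num_real//=.
      have : `|u p - dxi p.1| <= 2 * delta.
        have := h1 _ hp1; have := h2 p.1 p.2 hp1; rewrite -surjective_pairing !ler_norml.
        move=> /(_ _)/andP[].
          by clear - hp2 ra1 ra2; case/andP: hp2 => *; apply/andP; split; lra.
        by clear; move=> q1 q2 /andP[q3 q4]; apply/andP; split; lra.
      by have := normr_ge0 (u p - dxi p.1); move: `|_| => z; clear - delta0 => z0 zd; nra.
    by move/le_trans; apply; rewrite ips mulr1 ler_wpM2l// mulr_ge0// sqr_ge0.
  exists K, D1, D2; split => //.
  - have K0 : 0 <= K by clear - Kge re r0; lra.
    have GIX : G * (IX * K) <= G * (s' - s) * K.
      by rewrite -mulrA ler_wpM2l// ler_wpM2r.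
    move: A1P A2P JP => /andP[p1 p2] /andP[p3 p4] /andP[p5 p6].
    rewrite ler_norml; clearbody A1 A2 D1 D2 J K IX v.
    by clear - bal p1 p2 p3 p4 p5 p6 GIX; apply/andP; split; lra.
  - by split; [exact: D0 bc1|exact: D0 bc2].
  - by move=> c0; apply: (Dle _ _ _ bc1) => //; clear - c0 r0; lra.
  - by move=> d0; apply: (Dle _ _ _ bc2) => //; clear - d0 r0; lra.
have e0 : 0 < eps by clear - re r0; lra.
set Q := G * (s' - s) + 4 * eta.
have fin K D : eps / 2 <= K -> D <= 2 * delta ^+ 2 * (s' - s) -> 0 <= D ->
   D / K <= 4 * delta ^+ 2 * (s' - s) / eps.
  move=> Ke De D0; rewrite ler_pdivrMr; last by clear - Ke e0; lra.
  apply: (le_trans De); rewrite [leRHS]mulrAC ler_pdivlMr// .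
  have : 0 <= delta ^+ 2 * (s' - s) by rewrite mulr_ge0 ?sqr_ge0// subr_ge0 ltW.
  by move: (delta ^+ 2) => z; clear - Ke e0; nra.
(* For the strip on the right, dropping the far edge term - D2 <= 0 leaves an upper bound for the
   increment. For the strip on the left the far edge term is D1' >= 0, and dropping it leaves a
   lower bound. *)
have [|||K [D1 [D2 [Ke h [D10 D20] D1le _]]]] := side 0 eps;
  [by rewrite subr0|by clear - e0; lra|by []|].
have [|||K' [D1' [D2' [Ke' h' [D10' D20'] _ D2le]]]] := side (- eps) 0;
  [by rewrite sub0r opprK|by []|by clear - e0; lra|].
have {D1le}Dle := fin _ _ Ke (D1le erefl) D10.
have {D2le}Dle' := fin _ _ Ke' (D2le erefl) D20'.
have K0 : 0 < K by clear - Ke e0; lra.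
have K0' : 0 < K' by clear - Ke' e0; lra.
have DK : D1 = D1 / K * K by rewrite divfK// gt_eqF.
have DK' : D2' = D2' / K' * K' by rewrite divfK// gt_eqF.
rewrite -/(v s') -/(v s) -/Q; set B := 4 * _ * _ / _ in Dle Dle' *.
move: h h'; rewrite -!mulrDl -/Q DK DK' !ler_norml => /andP[_ h] /andP[h' _].
clearbody v Q B; clear - K0 K0' h h' D10' D20 Dle Dle'.
apply/andP; split.
- apply: (@le_trans _ _ (- Q - D2' / K')); first by clear - Dle'; lra.
  by rewrite -(ler_pM2r K0'); lra.
- apply: (@le_trans _ _ (Q + D1 / K)); last by clear - Dle; lra.
  by rewrite -(ler_pM2r K0); lra.
Qed.

(** * Construction of smooth approximate characteristics *)

(** Only p is confined to K: points of a strip around a curve in K may themselves lie outside K. *)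
Lemma compact_unif_continuous (R : realType) (u : R * R -> R) (K : set (R * R)) (e : R) :
  continuous u -> compact K -> 0 < e -> exists2 w, 0 < w & forall p q, K p ->
    `|p.1 - q.1| <= w -> `|p.2 - q.2| <= w -> `|u p - u q| <= e.
Proof.
move=> cu cK e0.
pose P (w : R) (p : R * R) := forall q, `|p.1 - q.1| <= w -> `|p.2 - q.2| <= w -> `|u p - u q| <= e.
have : \forall w \near 0^'+, forall p, K p -> P w p.
  apply: (compact_near_coveringP K).1 => // p Kp.
  have e20 : 0 < e / 2 by rewrite divr_gt0.
  have /cvgrPdist_le /(_ _ e20) /nbhs_ballP [k /= k0 kP] := cu p.
  exists (ball p (k / 2), [set w | w <= k / 2]) => /=.
    split; first by apply: nbhsx_ballx; rewrite divr_gt0.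
    by apply: nbhs_right_le; rewrite divr_gt0.
  move=> [p' w] [/= [] pp1 pp2 wk] q q1 q2.
  have h1 : `|u p - u p'| <= e / 2.
    apply: kP; split; [apply: le_ball pp1|apply: le_ball pp2];
      by rewrite ler_pdivrMr// ler_peMr ?ler1n ?ltW.
  have h2 : `|u p - u q| <= e / 2.
    apply: kP; split; rewrite /ball/=.
      have -> : p.1 - q.1 = (p.1 - p'.1) + (p'.1 - q.1) by ring.
      rewrite (le_lt_trans (ler_normD _ _))// [ltRHS]splitr ltr_leD//; exact: le_trans wk.
    have -> : p.2 - q.2 = (p.2 - p'.2) + (p'.2 - q.2) by ring.
    rewrite (le_lt_trans (ler_normD _ _))// [ltRHS]splitr ltr_leD//; exact: le_trans wk.
  have -> : u p' - u q = (u p - u q) - (u p - u p') by ring.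
  by rewrite (le_trans (ler_normB _ _))// [leRHS]splitr lerD.
move=> [w /= w0 wP]; exists (w / 2); first by rewrite divr_gt0.
move=> p q Kp; apply: wP => //=; last by rewrite divr_gt0.
by rewrite sub0r normrN gtr0_norm ?divr_gt0// ltr_pdivrMr// ltr_pMr// ltr1n.
Qed.

(** A smooth substitute for max(0, x), obtained as x S(x) from the smooth step S. The constant C
    limits how much the rounding of a corner can add to the slope error. *)
Lemma ramp_exists (R : realType) : exists (rho drho : R -> R) (C : R),
  [/\ forall k, Ck1 k rho, forall x : R, is_derive x 1 rho (drho x),
      (forall x, x <= 0 -> rho x = 0 /\ drho x = 0),
      (forall x, 1 <= x -> rho x = x) /\ (forall x, 1 < x -> drho x = 1) &
      0 <= C /\ forall x, 0 <= x <= 1 -> 0 <= rho x <= x /\ `|drho x| <= C].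
Proof.
have [S [s [SD SE [cs s0 sout] Smono [S0 S1]]]] := smooth_step_exists R.
have sl0 x : x < 0 -> s x = 0 by move=> x0; rewrite sout// leNgt x0.
have sr0 x : 1 < x -> s x = 0 by move=> x1; rewrite sout// negb_and orbC -ltNge x1.
have S01 x : 0 <= x <= 1 -> 0 <= S x <= 1.
  move=> /andP[x0 x1].
  by rewrite -[X in X <= S x](S0 0)// -[X in S x <= X](S1 1)// !Smono.
pose drho x := S x + x * s x.
have cn : continuous (fun x => `|drho x|).
  move=> x; apply: cvg_norm; apply: cvgD; first exact: (SD 0%N).
  by apply: cvgM; [exact: cvg_id|exact: cs].
have [m _ mmax] := EVT_max (@ler01 R) (continuous_subspaceT cn).
exists (fun x => x * S x), drho, `|drho m|; split.
- by move=> k; apply: Ck1M => //; exact: Ck1_id.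
- move=> x; apply: (is_derive_eq (is_deriveM (is_derive_id x 1) (SE x))).
  by rewrite /GRing.scale/= mulr1 addrC.
- move=> x; rewrite le_eqVlt /drho => /predU1P[->|x0].
    by rewrite !mul0r S0// addr0.
  by rewrite S0 ?(ltW x0)// sl0// !mulr0 addr0.
- split=> x x1; first by rewrite S1// mulr1.
  by rewrite /drho S1 ?(ltW x1)// sr0// mulr0 addr0.
- split=> // x x01; split; last by apply: mmax; rewrite in_itv.
  have /andP[x0 _] := x01; have /andP[h1 h2] := S01 _ x01.
  by rewrite mulr_ge0//= -[leRHS]mulr1 ler_wpM2l.
Qed.

(* An Euler polygon of step h: the corner at time a, where the slope changes from
   sigma to sigma', is rounded by adding (sigma' - sigma) h rho((t - a) / h). *)
Lemma approx_characteristic (R : realType) (F : R * R -> R) (x T delta : R) :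
  continuous F -> (forall p, `|F p| <= 1) -> 0 < T -> 0 < delta ->
  exists xi dxi : R -> R,
  [/\ forall k, Ck1 k xi, forall t : R, is_derive t 1 xi (dxi t), xi 0 = x,
      (forall t, 0 <= t <= T -> `|xi t - x| <= t) &
      forall t, 0 <= t <= T -> `|dxi t - F (t, xi t)| <= delta].
Proof.
move=> cF F1 T0 delta0.
have [rho [drho [C [rhoD rhoE rho0 [rho1 drho1] [C0 rho01]]]]] := ramp_exists R.
(* The slope error after a corner has three parts: d1 for sigma - sigma', C d1 for the ramp, and d1
   for the variation of F over one step. *)
pose d1 := delta / (2 + C).
have C20 : 0 < 2 + C by lra.
have d10 : 0 < d1 by rewrite divr_gt0.
have d1E : (2 + C) * d1 = delta by rewrite /d1 mulrCA divff ?mulr1// gt_eqF.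
have cK : compact ((`[0, T] `*` `[x - T, x + T]) : set (R * R)).
  by apply: compact_setX; exact: segment_compact.
have [w w0 wP] := compact_unif_continuous cF cK d10.
have [N NT] : exists N : nat, T / N.+1%:R <= w.
  have := archi_boundP (ltW (divr_gt0 T0 w0)); set N := Num.bound _ => TN.
  exists N; rewrite ler_pdivrMr// mulrC -ler_pdivrMr//.
  by rewrite (le_trans (ltW TN))// ler_nat.
pose h := T / N.+1%:R.
have h0 : 0 < h by rewrite divr_gt0.
have hw : h <= w by exact: NT.
have Nh : N.+1%:R * h = T by rewrite /h mulrCA divff ?mulr1// pnatr_eq0.
(* At every stage the curve is defined for all times and is straight beyond the last node; the next
   corner is added onto that straight continuation. *)
suff P k : (k <= N.+1)%N -> exists (xi dxi : R -> R) (sigma : R),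
  [/\ (forall k, Ck1 k xi) /\ (forall t : R, is_derive t 1 xi (dxi t)), xi 0 = x,
      (forall t, 0 <= t <= k%:R * h -> `|xi t - x| <= t) /\
      (forall t, 0 <= t <= k%:R * h -> `|dxi t - F (t, xi t)| <= delta),
      (forall t, k%:R * h <= t -> xi t = xi (k%:R * h) + sigma * (t - k%:R * h)) /\
      (forall t, k%:R * h < t -> dxi t = sigma) &
      `|sigma| <= 1 /\ `|sigma - F (k%:R * h, xi (k%:R * h))| <= d1].
  have [xi [dxi [sigma [[p1 p2] p3 [p4 p5] _ _]]]] := P _ (leqnn _).
  by exists xi, dxi; split => //; rewrite -Nh.
elim: k => [_|k IH kN].
  exists (fun t => x + F (0, x) * t), (fun=> F (0, x)), (F (0, x)).
  rewrite mul0r; split.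
  - split.
      move=> k; apply: Ck1D; first exact: Ck1_cst.
      by apply: Ck1M; [exact: Ck1_cst|exact: Ck1_id].
    move=> t; have h1 := is_deriveM (is_derive_cst (F (0, x) : R) t 1) (is_derive_id t 1).
    apply: (is_derive_eq (is_deriveD (is_derive_cst (x : R) t 1) h1)).
    by rewrite /GRing.scale/=; ring.
  - by rewrite mulr0 addr0.
  - split=> t t0; have -> : t = 0 by apply/eqP; rewrite eq_le andbC.
      by rewrite mulr0 addr0 subrr normr0.
    by rewrite mulr0 addr0 subrr normr0 ltW.
  - by split=> // t t0; ring.
  - by split=> //; rewrite mulr0 addr0 subrr normr0 ltW.
have [xi [dxi [sigma [[xiD xiE] xi0 [xi1 xi2] [xi3 xi4] [s1 s2]]]]] := IH (ltnW kN).
have k1E : k.+1%:R * h = k%:R * h + h by rewrite -natr1 mulrDl mul1r.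
have kh0 : 0 <= k%:R * h by rewrite mulr_ge0// ltW.
have khT : k%:R * h + h <= T by rewrite -k1E -Nh ler_pM2r// ler_nat.
rewrite k1E; move: (k%:R * h) kh0 khT xi1 xi2 xi3 xi4 s2 => a a0 aT xi1 xi2 xi3 xi4 s2.
pose sigma' := F (a, xi a).
pose zeta t := xi t + (sigma' - sigma) * (h * rho ((t - a) / h)).
pose dzeta t := dxi t + (sigma' - sigma) * drho ((t - a) / h).
have zetal t : t <= a -> zeta t = xi t /\ dzeta t = dxi t.
  move=> ta; have [|r1 r2] := rho0 ((t - a) / h).
    by rewrite ler_pdivrMr// mul0r subr_le0.
  by rewrite /zeta /dzeta r1 r2 !mulr0 !addr0.
have zetar t : a + h <= t -> zeta t = xi a + sigma' * (t - a).
  move=> ta; rewrite /zeta rho1; last by rewrite ler_pdivlMr// mul1r; lra.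
  rewrite xi3; last by lra.
  by field; rewrite gt_eqF.
have xia : `|xi a - x| <= a by apply: xi1; rewrite a0 lexx.
have mid t : a < t <= a + h -> `|zeta t - xi a| <= t - a /\
    `|dzeta t - F (t, zeta t)| <= delta.
  move=> /andP[ta th].
  have t01 : 0 <= (t - a) / h <= 1.
    by rewrite divr_ge0 ?subr_ge0 ?(ltW ta) ?(ltW h0)//= ler_pdivrMr// mul1r; lra.
  have [/andP[r0 r1] r2] := rho01 _ t01.
  have q1 : `|zeta t - xi a| <= t - a.
    rewrite /zeta xi3 ?(ltW ta)//; set y := h * _.
    have y0 : 0 <= y by rewrite mulr_ge0// ltW.
    have y1 : y <= t - a.
      have -> : t - a = h * ((t - a) / h) by rewrite mulrCA divff ?mulr1// gt_eqF.
      by rewrite ler_wpM2l// ltW.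
    clearbody y.
    (* Nonnegative weights t - a - y and y with sum t - a: as both slopes are at most 1 in absolute
       value, the rounded corner moves no faster than speed 1. *)
    have -> : xi a + sigma * (t - a) + (sigma' - sigma) * y - xi a =
      sigma * (t - a - y) + sigma' * y by ring.
    rewrite (le_trans (ler_normD _ _))// !normrM (ger0_norm y0).
    have ty0 : 0 <= t - a - y by rewrite subr_ge0.
    rewrite (ger0_norm ty0).
    have := F1 (a, xi a); rewrite -/sigma' => s'1.
    have : `|sigma| * (t - a - y) <= 1 * (t - a - y) by rewrite ler_wpM2r.
    have : `|sigma'| * y <= 1 * y by rewrite ler_wpM2r.
    by clear; lra.
  split => //.
  have q2 : `|sigma' - F (t, zeta t)| <= d1.
    apply: wP => /=.
    - split; rewrite /= in_itv/=; first by rewrite a0 (le_trans _ aT)// lerDl ltW.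
      clear - xia aT h0; move: xia; rewrite ler_norml => /andP[? ?].
      by apply/andP; split; lra.
    - by rewrite distrC ger0_norm ?subr_ge0 ?(ltW ta)// (le_trans _ hw)// lerBlDl.
    - by rewrite distrC (le_trans q1)// (le_trans _ hw)// lerBlDl.
  have -> : dzeta t - F (t, zeta t) = (sigma - sigma') + (sigma' - sigma) * drho ((t - a) / h)
      + (sigma' - F (t, zeta t)).
    by rewrite /dzeta xi4//; ring.
  rewrite -d1E (le_trans (ler_normD _ _))//.
  have : `|sigma - sigma' + (sigma' - sigma) * drho ((t - a) / h)| <= d1 + d1 * C.
    rewrite (le_trans (ler_normD _ _))// lerD// normrM distrC.
    by apply: ler_pM => //; rewrite distrC.
  by clear - q2; lra.
exists zeta, dzeta, sigma'; split.
- split.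
    move=> j; apply: Ck1D => //; apply: Ck1M; first exact: Ck1_cst.
    apply: Ck1M; first exact: Ck1_cst.
    apply: (@Ck1_comp _ _ rho (fun t => (t - a) / h)) => //.
    by apply: Ck1M; [apply: Ck1D; [exact: Ck1_id|exact: Ck1_cst]|exact: Ck1_cst].
  move=> t; have h1 := @is_derive_affine _ rho drho a h t rhoE.
  have h2 := is_deriveM (is_derive_cst (h : R) t 1) h1.
  have h3 := is_deriveM (is_derive_cst (sigma' - sigma : R) t 1) h2.
  apply: (is_derive_eq (is_deriveD (xiE t) h3)).
  by rewrite /GRing.scale/= /dzeta; field; rewrite gt_eqF.
- by have [-> _] := zetal 0 a0.
- split=> t /andP[t0 t1].
    have [ta|ta] := leP t a.
      by have [-> _] := zetal t ta; apply: xi1; rewrite t0.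
    have [|m1 _] := mid t; first by rewrite ta.
    have -> : zeta t - x = (zeta t - xi a) + (xi a - x) by ring.
    by rewrite (le_trans (ler_normD _ _))//; lra.
  have [ta|ta] := leP t a.
    by have [-> ->] := zetal t ta; apply: xi2; rewrite t0.
  by have [|_ //] := mid t; rewrite ta.
- split=> t ta; first by rewrite !zetar//; ring.
  rewrite /dzeta drho1; last by rewrite ltr_pdivlMr// mul1r; lra.
  by rewrite xi4; [ring|lra].
- split; first exact: F1.
  apply: wP => /=.
  + split; rewrite /= in_itv/=; first by rewrite a0 (le_trans _ aT)// lerDl ltW.
    clear - xia aT h0; move: xia; rewrite ler_norml => /andP[? ?].
    by apply/andP; split; lra.
  + by rewrite distrC addrAC subrr add0r ger0_norm ?(ltW h0).
  + rewrite distrC; have [|m1 _] := mid (a + h); first by rewrite ltrDl h0 lexx.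
    by rewrite (le_trans m1)// addrAC subrr add0r.
Qed.

(** * Essentially bounded sources *)

Lemma Linfty_norm_ae (R : realType) (g : R * R -> R) : Linfty g ->
  0 <= Linfty_norm g /\ {ae lebesgue2 R, forall p, `|g p| <= Linfty_norm g}.
Proof.
rewrite /Linfty => /sub_Lfun_finLfun; rewrite inE/= /finite_norm /Linfty_norm => gfin.
split; first by rewrite fine_ge0// Lnorm_ge0.
have NE : ((fine 'N[lebesgue2 R]_+oo[EFin \o g])%:E = 'N[lebesgue2 R]_+oo[EFin \o g])%E.
  by rewrite fineK// ge0_fin_numE// Lnorm_ge0.
(* The norm at +oo is the essential supremum on a space of positive measure and 0 by convention
   otherwise; in the latter case every property holds almost everywhere. *)
have [mu0|mu0] := boolP (0 < lebesgue2 R setT)%E.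
  have := ess_sup_ge (lebesgue2 R) (abse \o (EFin \o g)).
  apply: filterS => p; rewrite -lee_fin NE unlock /= mu0 => h.
  exact: h.
have {}mu0 : (lebesgue2 R setT = 0)%E.
  by apply/eqP; rewrite eq_le measure_ge0 andbT leNgt.
by exists setT; split.
Qed.

(** Truncating g to [- G, G] changes it on a null set only, so no integral against a test function
    changes, while the bound becomes valid at every point. *)
Lemma Linfty_bounded_source (R : realType) (g u : R * R -> R) :
  Linfty g -> burgers_solution g u -> exists g' : R * R -> R,
  [/\ measurable_fun [set: measurableTypeR R * measurableTypeR R] g',
      forall p, `|g' p| <= Linfty_norm g & burgers_solution g' u].
Proof.
move=> gL sol; have [G0 gae] := Linfty_norm_ae gL.
have mg : measurable_fun [set: measurableTypeR R * measurableTypeR R] g.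
  by have := sub_Lfun_mfun gL; rewrite inE.
set G := Linfty_norm g in G0 gae *.
pose g' p := Num.max (- G) (Num.min (g p) G).
have mg' : measurable_fun [set: measurableTypeR R * measurableTypeR R] g'.
  by apply: measurable_maxr => //; exact: measurable_minr.
exists g'; split => //.
  move=> p; rewrite /g' ler_norml le_max lexx/= ge_max ge_min lexx orbT andbT.
  by rewrite (le_trans _ G0)// oppr_le0.
move=> phi tphi; rewrite (sol phi tphi) /Rintegral; congr fine.
have mphi : measurable_fun [set: measurableTypeR R * measurableTypeR R] phi.
  by apply: continuous_measurable2; have [/(_ 0%N)[]] := tphi.
apply: ae_eq_integral => //.
- by apply/measurable_EFinP; exact: measurable_funM.
- by apply/measurable_EFinP; exact: measurable_funM.
- apply: (@filterS _ _ (ae_filter_ringOfSetsType (lebesgue2 R)) _ _ _ gae) => p.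
  by rewrite ler_norml => /andP[h1 h2] _; rewrite /g' (min_idPl h2) (max_idPr h1).
Qed.

(** * From Lipschitz bounds along characteristics to the Hölder bound in space *)

(** The sign [sg] is the direction of time: [zeta] is parametrised by elapsed time, so forward and
    backward curves are treated at once. *)
Lemma lipschitz_along_characteristics (R : realType) (g u : R * R -> R)
    (G sg t0 x0 T e : R) :
  measurable_fun [set: measurableTypeR R * measurableTypeR R] g ->
  (forall p, `|g p| <= G) -> continuous u -> (forall p, 0 <= u p <= 1) ->
  burgers_solution g u ->
  sg = 1 \/ sg = -1 -> 0 < T -> 0 < e ->
  exists zeta dzeta : R -> R,
  [/\ forall t : R, is_derive t 1 zeta (dzeta t), zeta 0 = x0,
      forall t, 0 <= t <= T -> `|dzeta t - sg * u (t0 + sg * t, zeta t)| <= e &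
      forall t, 0 <= t <= T -> `|u (t0 + sg * t, zeta t) - u (t0, x0)| <= G * t + e].
Proof.
move=> mg gG cu u01 sol sgP T0 e0.
have sg1 : `|sg| = 1 by case: sgP => ->; rewrite ?normrN normr1.
have sg2 : sg * sg = 1 by case: sgP => ->; rewrite ?mulrNN mulr1.
pose F (p : R * R) := sg * u (t0 + sg * p.1, p.2).
have cF : continuous F.
  move=> p; apply: cvgM; first exact: cvg_cst.
  apply: (@continuous_comp _ _ _ (fun p : R * R => (t0 + sg * p.1, p.2)) u); last exact: cu.
  have h1 : (t0 + sg * q.1) @[q --> p] --> t0 + sg * p.1.
    by apply: cvgD; [exact: cvg_cst|apply: cvgM; [exact: cvg_cst|exact: cvg_fst]].
  exact: (cvg_pair h1 (@cvg_snd _ _ _ _ _)).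
have F1 p : `|F p| <= 1.
  by rewrite normrM sg1 mul1r; have /andP[? ?] := u01 (t0 + sg * p.1, p.2); rewrite ger0_norm.
have cK : compact ((`[t0 - T, t0 + T] `*` `[x0 - T, x0 + T]) : set (R * R)).
  by apply: compact_setX; exact: segment_compact.
(* The error [e] is split in two: eta = e / 8 makes 4 eta = e / 2, and since delta <= 1, delta^2 <=
   delta <= e eps / (8 T) makes the near edge term at most e / 2. The bound delta <= e is for the
   slope. *)
have e80 : 0 < e / 8 by rewrite divr_gt0.
have [eps eps0 epsP] := compact_unif_continuous cu cK e80.
pose delta := Num.min e (Num.min 1 (e * eps / (8 * T))).
have delta0 : 0 < delta.
  by rewrite !lt_min e0 ltr01/= divr_gt0// mulr_gt0.
have [de [d1 dT]] : delta <= e /\ delta <= 1 /\ delta <= e * eps / (8 * T).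
  by rewrite /delta !ge_min !lexx !orbT.
have [w w0 wP] := compact_unif_continuous cu cK delta0.
pose r := Num.min w (eps / 4).
have r0 : 0 < r by rewrite lt_min w0/= divr_gt0.
have [rw r4] : r <= w /\ r <= eps / 4 by rewrite /r !ge_min !lexx !orbT.
have [zeta [dzeta [zetaD zetaE zeta0 zeta1 zeta2]]] :=
  approx_characteristic x0 cF F1 T0 delta0.
exists zeta, dzeta; split => //.
  by move=> t tT; rewrite (le_trans (zeta2 _ tT)).
move=> tau /andP[]; rewrite le_eqVlt => /predU1P[<- _|tau0 tauT].
  by rewrite !mulr0 addr0 zeta0 subrr normr0 add0r ltW.
(* In physical time the slope is sg zeta', close to sg^2 u = u: for either sign [xi] is an
   approximate characteristic, as [char_bound] requires. *)
pose xi t := zeta (sg * (t - t0)).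
pose dxi t := sg * dzeta (sg * (t - t0)).
have xiD k : Ck1 k xi.
  apply: (@Ck1_comp _ _ zeta (fun t => sg * (t - t0))) => //.
  by apply: Ck1M; [exact: Ck1_cst|apply: Ck1D; [exact: Ck1_id|exact: Ck1_cst]].
have xiE (t : R) : is_derive t 1 xi (dxi t).
  have h : is_derive t 1 (fun t : R => sg * (t - t0)) sg.
    have h1 := is_deriveB (is_derive_id t 1) (is_derive_cst (t0 : R) t 1).
    apply: (is_derive_eq (is_deriveM (is_derive_cst (sg : R) t 1) h1)).
    by rewrite /GRing.scale/=; ring.
  apply: (is_derive_eq (@is_derive1_comp _ zeta (fun t => sg * (t - t0)) t _ _ (zetaE _) h)).
  by rewrite /dxi mulrC.
pose inT t := 0 <= sg * (t - t0) <= tau.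
have inK t : inT t -> ((`[t0 - T, t0 + T] `*` `[x0 - T, x0 + T]) : set (R * R)) (t, xi t).
  move=> /andP[t1 t2]; have tT : 0 <= sg * (t - t0) <= T by rewrite t1 (le_trans t2).
  have := zeta1 _ tT; rewrite -/(xi t) ler_norml => /andP[x1 x2].
  clear - sgP tauT t1 t2 x1 x2.
  split; rewrite /= in_itv/=; apply/andP; split; move: t1 t2 x1 x2;
    by case: sgP => ->; rewrite ?mul1r ?mulN1r; lra.
have key s s' : s < s' -> s' - s = tau -> (forall t, s <= t <= s' -> inT t) ->
    `|u (s', xi s') - u (s, xi s)| <= G * tau + e.
  move=> ss' stau sin.
  have := @char_bound R g u G xi dxi s s' delta eps (e / 8) r mg gG cu u01 sol xiD xiE ss' r0.
  rewrite stau => h; apply: (le_trans (h _ _ _ _ _)) => //.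
  - by rewrite mulrC -ler_pdivlMr.
  - move=> t /sin tin; have /andP[t1 t2] := tin.
    have tT : 0 <= sg * (t - t0) <= T by rewrite t1 (le_trans t2).
    have := zeta2 _ tT; rewrite /F /= -/(xi t) mulrA sg2 mul1r subrKC => h2.
    rewrite -[u _]mul1r -sg2 -mulrA /dxi -mulrBr normrM sg1 mul1r distrC.
    exact: h2.
  - move=> t x /sin tin tx; rewrite distrC; apply: (wP (t, xi t) (t, x) (inK _ tin)) => /=.
      by rewrite subrr normr0 ltW.
    by rewrite distrC (le_trans tx).
  - move=> t x /sin tin tx; rewrite distrC; apply: (epsP (t, xi t) (t, x) (inK _ tin)) => /=.
      by rewrite subrr normr0 ltW.
    by rewrite distrC.
  - have : 4 * delta ^+ 2 * tau / eps <= e / 2.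
      rewrite ler_pdivrMr//.
      have q1 : delta ^+ 2 <= e * eps / (8 * T).
        by rewrite expr2 (le_trans _ dT)// ler_piMl// ltW.
      have q2 : delta ^+ 2 * tau <= e * eps / (8 * T) * T.
        by apply: ler_pM => //; [exact: sqr_ge0|exact: ltW].
      have q3 : e * eps / (8 * T) * T = e * eps / 8 by field; rewrite gt_eqF.
      by rewrite q3 in q2; clear - q2; lra.
    by clear; lra.
case: (sgP) => sgE.
- have -> : u (t0 + sg * tau, zeta tau) = u (t0 + tau, xi (t0 + tau)).
    by rewrite /xi sgE; congr (u (_, zeta _)); ring.
  have -> : u (t0, x0) = u (t0, xi t0) by rewrite /xi subrr mulr0 zeta0.
  apply: key; [by clear - tau0; lra|by ring|].
  move=> t /andP[t1 t2]; rewrite /inT sgE mul1r; clear - t1 t2.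
  by apply/andP; split; lra.
- have -> : u (t0 + sg * tau, zeta tau) = u (t0 - tau, xi (t0 - tau)).
    by rewrite /xi sgE; congr (u (_, zeta _)); ring.
  have -> : u (t0, x0) = u (t0, xi t0) by rewrite /xi subrr mulr0 zeta0.
  rewrite distrC; apply: key; [by clear - tau0; lra|by ring|].
  move=> t /andP[t1 t2]; rewrite /inT sgE mulN1r; clear - t1 t2.
  by apply/andP; split; lra.
Qed.

Lemma squared_increment_le (R : realType) (g u : R * R -> R) (G t x y : R) :
  measurable_fun [set: measurableTypeR R * measurableTypeR R] g ->
  (forall p, `|g p| <= G) -> continuous u -> (forall p, 0 <= u p <= 1) ->
  burgers_solution g u -> 0 < G -> x < y ->
  (u (t, x) - u (t, y)) ^+ 2 <= 32 * G * (y - x).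
Proof.
move=> mg gG cu u01 sol G0 xy; rewrite leNgt; apply/negP => lt_sq.
set a := u (t, x) in lt_sq *; set b := u (t, y) in lt_sq *.
pose d := `|a - b|.
have dE : (a - b) ^+ 2 = d ^+ 2 by rewrite /d real_normK ?num_real.
have ab : a != b.
  apply: contraTneq lt_sq => ->; rewrite subrr expr0n/= -leNgt.
  by rewrite mulr_ge0 ?subr_ge0 ?(ltW xy)// mulr_ge0// ltW.
have d0 : 0 < d by rewrite normr_gt0 subr_eq0.
pose T := d / (8 * G).
have T0 : 0 < T by rewrite divr_gt0// mulr_gt0.
have GT : G * T = d / 8 by rewrite /T; field; rewrite gt_eqF.
(* The constant 32 is 8 times 4: the duration d / (8 G) times a closing speed of at least d / 4. *)
have LT : y - x < T * d / 4.
  rewrite dE in lt_sq.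
  have -> : T * d / 4 = d ^+ 2 / (32 * G) by rewrite /T; field; rewrite gt_eqF.
  by rewrite ltr_pdivlMr ?mulr_gt0// mulrC.
(* Forward in time if u is larger at the left point x, backward otherwise: either way the left curve
   gains on the right one. *)
have [sg sgP sgE] : exists2 sg : R, sg = 1 \/ sg = -1 & sg * (a - b) = d.
  have [h|h] := ltP 0 (a - b).
    by exists 1; [left|rewrite mul1r /d gtr0_norm].
  by exists (-1); [right|rewrite mulN1r /d ler0_norm].
have e0 : 0 < d / 16 by rewrite divr_gt0.
have [X [dX [XE X0 X1 X2]]] :=
  @lipschitz_along_characteristics R g u G sg t x T (d / 16) mg gG cu u01 sol sgP T0 e0.
have [Y [dY [YE Y0 Y1 Y2]]] :=
  @lipschitz_along_characteristics R g u G sg t y T (d / 16) mg gG cu u01 sol sgP T0 e0.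
rewrite -/a in X2; rewrite -/b in Y2.
have bound s : 0 <= s <= T -> G * s <= d / 8.
  by move=> /andP[_ sT]; rewrite -GT ler_pM2l.
have DE (s : R) : is_derive s 1 (fun s => Y s - X s) (dY s - dX s).
  exact: is_deriveB.
have cD : continuous (fun s => Y s - X s) by exact: is_derive_continuous DE.
have [c cT cE] := @MVT_segment R (fun s => Y s - X s) (fun s => dY s - dX s) 0 T (ltW T0)
  (fun s _ => DE s) (continuous_subspaceT cD).
have cT' : 0 <= c <= T by move: cT; rewrite in_itv.
have DT : Y T - X T <= 0.
  (* Each value of u drifts by at most d/8 + d/16, so the gap stays at least 5d/8; two slope errors
     of d/16 leave a closing speed of d/2, more than needed. *)
  have slope : dY c - dX c <= - (d / 4).
    move: (X1 _ cT') (Y1 _ cT') (X2 _ cT') (Y2 _ cT') (bound _ cT').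
    move: (u (_, X c)) (u (_, Y c)) => ux uy; rewrite !ler_norml.
    move=> /andP[a1 a2] /andP[b1 b2] /andP[c1 c2] /andP[d1 d2] q.
    clear - sgE sgP a1 a2 b1 b2 c1 c2 d1 d2 q.
    by move: sgE a1 a2 b1 b2; case: sgP => ->; rewrite ?mul1r ?mulN1r; lra.
  rewrite X0 Y0 subr0 in cE.
  have : (dY c - dX c) * T <= - (d / 4) * T by rewrite ler_pM2r.
  by rewrite -cE; lra.
have [s sT Ds0] : exists2 s, s \in `[0, T] & Y s - X s = 0.
  apply: (@IVT R (fun s => Y s - X s) 0 T 0 (ltW T0)).
    exact: continuous_subspaceT.
  by rewrite X0 Y0 ge_min le_max DT orbT subr_ge0 (ltW xy).
have sT' : 0 <= s <= T by move: sT; rewrite in_itv.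
have XY : Y s = X s by apply/eqP; rewrite -subr_eq0 Ds0.
(* At the meeting point one value of u lies within 3d/16 of both a and b, although these are d
   apart. *)
move: (X2 _ sT') (Y2 _ sT') (bound _ sT'); rewrite XY.
move: (u (_, X s)) => v; rewrite !ler_norml => /andP[a1 a2] /andP[b1 b2] q.
clear - sgE sgP d0 a1 a2 b1 b2 q.
by move: sgE; case: sgP => ->; rewrite ?mul1r ?mulN1r; lra.
Qed.

Theorem corollary9 (R : realType) (g u : R * R -> R)
    (g_Linfty : Linfty g)
    (u_cont : continuous u)
    (u_range : forall p, 0 <= u p <= 1)
    (u_sol : burgers_solution g u)
    (u_isentropic : isentropic g u) :
  forall t : R,
    hoelder_le (2^-1) (100 * Num.sqrt (20 * Linfty_norm g))
      (fun x => u (t, x)).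
Proof.
move=> t.
have [G0 _] := Linfty_norm_ae g_Linfty.
have [g' [mg' g'G sol']] := Linfty_bounded_source g_Linfty u_sol.
set G := Linfty_norm g in G0 g'G *.
have sq x y : x < y -> (u (t, x) - u (t, y)) ^+ 2 <= 32 * G * (y - x).
  (* The duration d / (8 G) requires G > 0, but the norm may vanish; G is enlarged by an amount that
     raises the final bound by exactly e. *)
  move=> xy; apply/ler_addgt0Pr => e e0.
  have q0 : 0 < e / (32 * (y - x)) by rewrite divr_gt0// mulr_gt0// subr_gt0.
  have g'e p : `|g' p| <= G + e / (32 * (y - x)) by rewrite (le_trans (g'G p))// lerDl ltW.
  apply: (le_trans (@squared_increment_le R g' u _ t x y mg' g'e u_cont u_range sol' _ xy)).
    exact: ltr_wpDl.
  have -> // : 32 * (G + e / (32 * (y - x))) * (y - x) = 32 * G * (y - x) + e.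
  by field; rewrite gt_eqF// subr_gt0.
move=> x y; rewrite powR12_sqrt//.
have sqxy : (u (t, x) - u (t, y)) ^+ 2 <= 32 * G * `|x - y|.
  have [xy|xy|->] := ltgtP x y; last by rewrite !subrr normr0 mulr0 expr0n.
    by rewrite distrC gtr0_norm ?subr_gt0//; exact: sq.
  by rewrite gtr0_norm ?subr_gt0// -sqrrN opprB; exact: sq.
rewrite -ler_sqr ?nnegrE ?mulr_ge0 ?sqrtr_ge0// real_normK ?num_real//.
apply: (le_trans sqxy); rewrite !exprMn !sqr_sqrtr ?mulr_ge0//.
(* What remains is 32 <= 100^2 * 20 as coefficients of this nonnegative quantity. *)
have : 0 <= G * `|x - y| by rewrite mulr_ge0.
by lra.
Qed.
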